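(* Let $X$ be a separable real Banach space. Then there exists an equivalent norm $|||\cdot|||$ on $X$ such that for every closed linear subspace $Y$ of $X$: $Y$ is reflexive if and only if condition (a) below holds for all bounded sequences $(x_n)\subseteq Y$; and likewise $Y$ is reflexive if and only if both conditions (a) and (b) below hold for all bounded sequences $(x_n)\subseteq Y$. (a) If $\lim_{m\to\infty}\lim_{n\to\infty}|||x_m+x_n|||=2\lim_{n\to\infty}|||x_n|||$, then $(x_n)$ is norm convergent. (b) If $(x_n)$ is weakly null but not norm null, then $\lim_{m\to\infty}\lim_{n\to\infty}|||x_m+x_n|||>\lim_{m\to\infty}|||x_m|||$, provided both limits exist.
   Context: A hypothesis stated as an equality of limits includes the assumption that all the limits (including the inner limits of iterated limits, for each value of the outer index) exist. *)

(* Defs.v *)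
From HB Require Import structures.
From mathcomp Require Import all_boot all_order all_algebra.
From mathcomp Require Import all_classical all_reals all_analysis.

Set Implicit Arguments.
Unset Strict Implicit.
Unset Printing Implicit Defensive.

Import Order.TTheory GRing.Theory Num.Theory.
Import numFieldNormedType.Exports.

Local Open Scope classical_set_scope.
Local Open Scope ring_scope.

Section Sublmod.
Variables (R : realType) (V : normedModType R) (Y : submodClosed V).

Record sublmod := Sublmod { sublmod_val : V; _ : sublmod_val \in Y }.

HB.instance Definition _ := [isSub for sublmod_val].
HB.instance Definition _ := [Choice of sublmod by <:].
HB.instance Definition _ := [SubChoice_isSubLmodule of sublmod by <:].

Let norm (y : sublmod) : R := `|\val y|.

Let ler_normD x y : norm (x + y) <= norm x + norm y.
Proof. by rewrite /norm raddfD ler_normD. Qed.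

Let normrZ (a : R) x : norm (a *: x) = `|a| * norm x.
Proof. by rewrite /norm linearZ normrZ. Qed.

Let normr0_eq0 x : norm x = 0 -> x = 0.
Proof. by move=> /normr0_eq0 x0; apply: val_inj; rewrite x0 raddf0. Qed.

HB.instance Definition _ :=
  Lmodule_isNormed.Build R sublmod ler_normD normrZ normr0_eq0.

Lemma sublmod_normE (y : sublmod) : `|y| = `|\val y|.
Proof. by []. Qed.

End Sublmod.

Section Dual.
Variables (R : realType) (V : normedModType R).

Definition dual_pred : {pred V -> R^o} :=
  mem [set f : V -> R^o | linear f /\ continuous f].

Let dual_submod_closed : submod_closed dual_pred.
Proof.
split.
  rewrite !inE; split; last exact: cst_continuous.
  move=> a x y; change ((0 : R^o) = a *: (0 : R^o) + 0).
  by rewrite scaler0 addr0.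
move=> a f g; rewrite !inE => -[lf cf] [lg cg]; split.
  move=> b x y.
  change (a *: f (b *: x + y) + g (b *: x + y) =
    b *: (a *: f x + g x) + (a *: f y + g y)).
  by rewrite lf lg !scalerDr !scalerA [b * a]mulrC addrACA.
by move=> x; apply: cvgD; [apply: cvgZr; exact: cf|exact: cg].
Qed.

HB.instance Definition _ :=
  GRing.isSubmodClosed.Build R _ dual_pred dual_submod_closed.

Record dual := Dual { dual_val :> V -> R^o; _ : dual_val \in dual_pred }.

HB.instance Definition _ := [isSub for dual_val].
HB.instance Definition _ := [Choice of dual by <:].
HB.instance Definition _ := [SubChoice_isSubLmodule of dual by <:].

Lemma dualP (f : dual) : linear f /\ continuous f.
Proof. by have := valP f; rewrite inE. Qed.

Definition dual_norm (f : dual) : R :=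
  sup [set `|f x| | x in [set x : V | `|x| <= 1]].

Let pack_linear (f : V -> R^o) (lf : linear f) : {linear V -> R^o} :=
  HB.pack f (GRing.isLinear.Build _ _ _ _ _ lf).

Lemma dual_has_sup (f : dual) :
  has_sup [set `|f x| | x in [set x : V | `|x| <= 1]].
Proof.
split; first by exists `|f 0|, 0 => //=; rewrite normr0.
have [lf cf] := dualP f.
have /linear_boundedP : bounded_near (pack_linear lf) (nbhs (0 : V)).
  exact/continuous_linear_bounded/cf.
move=> [M [_ /(_ (`|M| + 1))]].
have M1 : M < `|M| + 1 by rewrite (le_lt_trans (ler_norm M))// ltrDl.
move=> /(_ M1) fM; exists (`|M| + 1) => _ [x /= x1 <-].
by rewrite (le_trans (fM x))// ler_piMr// addr_ge0.
Qed.

Lemma dual_norm_ub (f : dual) (x : V) : `|x| <= 1 -> `|f x| <= dual_norm f.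
Proof.
by move=> x1; apply: ub_le_sup; [exact: (dual_has_sup f).2|exists x].
Qed.

Lemma dual_norm_ge0 (f : dual) : 0 <= dual_norm f.
Proof. by rewrite (le_trans _ (dual_norm_ub f (x := 0) _)) ?normr0. Qed.

Lemma dual_norm_le (f : dual) (M : R) :
  (forall x : V, `|x| <= 1 -> `|f x| <= M) -> dual_norm f <= M.
Proof.
move=> fM; apply: ge_sup; first exact: (dual_has_sup f).1.
by move=> _ [x x1 <-]; exact: fM.
Qed.

Let ler_dual_normD f g : dual_norm (f + g) <= dual_norm f + dual_norm g.
Proof.
apply: dual_norm_le => x x1; rewrite (le_trans (ler_normD _ _))//.
by rewrite lerD// dual_norm_ub.
Qed.

Let dual_normZ_le (a : R) f : dual_norm (a *: f) <= `|a| * dual_norm f.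
Proof.
apply: dual_norm_le => x x1.
rewrite [(a *: f) x]/(_ *: _) normrZ.
by rewrite ler_wpM2l// dual_norm_ub.
Qed.

Let dual_normZ (a : R) f : dual_norm (a *: f) = `|a| * dual_norm f.
Proof.
apply/le_anti; rewrite dual_normZ_le/=.
have [->|a0] := eqVneq a 0; first by rewrite normr0 mul0r dual_norm_ge0.
rewrite -[in leLHS](scalerK a0 f) -ler_pdivlMl ?normr_gt0//.
by rewrite -normfV dual_normZ_le.
Qed.

Let dual_norm_eq0 f : dual_norm f = 0 -> f = 0.
Proof.
move=> f0; have [lf cf] := dualP f; apply/val_inj/funext => x /=.
have [->|x0] := eqVneq x 0; first exact: (raddf0 (pack_linear lf)).
have nx0 : `|x| != 0 by rewrite normr_eq0.
have /(dual_norm_ub f) : `| `|x|^-1 *: x| <= 1.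
  by rewrite normrZ normfV normr_id mulVf.
rewrite f0 normr_le0 -[f _]/(pack_linear lf _) linearZ/= scaler_eq0.
by rewrite invr_eq0 (negbTE nx0)/= => /eqP.
Qed.

HB.instance Definition _ :=
  Lmodule_isNormed.Build R dual ler_dual_normD dual_normZ dual_norm_eq0.

Lemma dual_normE (f : dual) : `|f| = dual_norm f.
Proof. by []. Qed.

End Dual.

(* Surjectivity of the evaluation map V -> V**. *)
Definition reflexive_space (R : realType) (V : normedModType R) : Prop :=
  forall Phi : dual (dual V), exists x : V, forall f : dual V, Phi f = f x.

Definition separable_space (T : topologicalType) : Prop :=
  exists2 D : set T, countable D & dense D.

Section Renorming.
Variables (R : realType) (X : normedModType R).

Record equivalent_norm (N : X -> R) : Prop := EquivalentNorm {
  equivalent_normD : forall x y, N (x + y) <= N x + N y;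
  equivalent_normZ : forall (a : R) x, N (a *: x) = `|a| * N x;
  equivalent_norm_eq0 : forall x, N x = 0 -> x = 0;
  equivalent_norm_bounds : exists c C : R, [/\ 0 < c, 0 < C &
    forall x, c * `|x| <= N x <= C * `|x|] }.

Definition weakly_null (x : X^nat) : Prop :=
  forall f : dual X, f (x n) @[n --> \oo] --> (0 : R^o).

(* [limn] is total: an iterated limit is meaningful only under this
   predicate. *)
Definition ex_iterated_lim (u : nat -> nat -> R) : Prop :=
  (forall m, cvgn (u m)) /\ cvgn (fun m => limn (u m)).

Definition iterated_lim (u : nat -> nat -> R) : R :=
  limn (fun m => limn (u m)).

Definition condition_a (N : X -> R) (x : X^nat) : Prop :=
  ex_iterated_lim (fun m n => N (x m + x n)) ->
  cvgn (fun n => N (x n)) ->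
  iterated_lim (fun m n => N (x m + x n)) = 2 * limn (fun n => N (x n)) ->
  cvgn x.

Definition condition_b (N : X -> R) (x : X^nat) : Prop :=
  weakly_null x -> ~ (x @ \oo --> (0 : X)) ->
  ex_iterated_lim (fun m n => N (x m + x n)) ->
  cvgn (fun m => N (x m)) ->
  iterated_lim (fun m n => N (x m + x n)) > limn (fun m => N (x m)).

End Renorming.

(* Main.v *)
Require Import Defs.
From HB Require Import structures.
From mathcomp Require Import all_boot all_order all_algebra.
From mathcomp Require Import all_classical all_reals all_analysis.
From mathcomp Require Import ring lra.

(** The norm is N x = sum_j w_j (| |x| c_j + x | + | |x| c_j - x |), with (c_j)
    dense (Odell and Schlumprecht). An extremal equality for N passes to each
    summand. Hence, with limits along a free ultrafilter, the hypothesis of (a)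
    gives lim_m lim_n |2c + x_m + x_n| = 2 lim_n |c + x_n| for all c, and the
    failure of (b) gives lim_m lim_n |c + x_m + x_n| = lim_n |c + x_n|.

    In a reflexive subspace, initial and final convex hulls of a bounded sequence
    come arbitrarily close (Mazur applied twice to a weak limit). If (x_n) stays
    away from every point in the first case, a subsequence has initial and final
    hulls at positive distance; in the second case the partial sums of a
    subsequence are bounded and have this property. So (x_n) converges along
    every free ultrafilter, to a unique limit since N is strictly convex enough.

    Conversely, for Phi in Y** choose functionals f_k of N-dual norm at most one
    with Phi f_k tending to the norm M of Phi, and y_k with N y_k close to M that
    almost agree with Phi on f_0, ..., f_k and on a given g. A subsequence of
    (y_k) falls under (a), so it converges to some z with g z = Phi g; applying
    (a) to z, z', z, z', ... shows that z does not depend on g. *)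

Set Implicit Arguments.
Unset Strict Implicit.
Unset Printing Implicit Defensive.

Import Order.TTheory GRing.Theory Num.Theory.
Import numFieldNormedType.Exports.

Local Open Scope classical_set_scope.
Local Open Scope ring_scope.

(** * Sublinear functionals *)

(** The hypotheses of (a) and (b) concern [N] alone; on its summands ordinary limits may fail to
    exist. Along a free ultrafilter every bounded quantity has a limit, so summands can be compared
    one by one, and the weak limit of a bounded sequence is an element of the bidual that
    reflexivity turns into a point. The factor |x| in the tilt makes each summand homogeneous; in an
    ultralimit it freezes to a constant r > 0, and the tilt c / r then yields the norms of the
    translates c + x and c - x.

    The identities so obtained hold only in the limit and for one vector c at a time, while the
    choice of a term must respect all combinations of the earlier ones. Those combinations are
    therefore kept in compact sets, on which strict lower bounds become uniform. Separation of
    initial from final hulls is an invariant of this selection. *)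

Section LinearFunctionals.
Variables (R : realType) (W : lmodType R).

Lemma linear_comb0 (f : W -> R^o) : linear f -> f 0 = 0.
Proof. by move=> lf; have := lf (-1) 0 0; rewrite scaler0 addr0 scaleN1r addNr. Qed.

Lemma linear_combZ (f : W -> R^o) : linear f ->
  forall (a : R) x, f (a *: x) = a * f x.
Proof.
by move=> lf a x; have := lf a x 0; rewrite addr0 (linear_comb0 lf) addr0.
Qed.

Lemma linear_combD (f : W -> R^o) : linear f ->
  forall x y, f (x + y) = f x + f y.
Proof. by move=> lf x y; have := lf 1 x y; rewrite !scale1r. Qed.

Lemma linear_combN (f : W -> R^o) : linear f ->
  forall x, f (- x) = - f x.
Proof. by move=> lf x; rewrite -scaleN1r (linear_combZ lf) mulN1r. Qed.

End LinearFunctionals.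

Section SublinearFunctionals.
Variables (R : realType) (V : lmodType R).
Implicit Types (p q : V -> R) (T : set (V * R)).

Definition sublinear p :=
  (forall x y, p (x + y) <= p x + p y) /\
  (forall (a : R) x, 0 <= a -> p (a *: x) = a * p x).

Definition cone_below T p :=
  [/\ T (0, 0),
      forall y s z t, T (y, s) -> T (z, t) -> T (y + z, s + t),
      forall (a : R) y s, 0 <= a -> T (y, s) -> T (a *: y, a * s) &
      forall y s, T (y, s) -> s <= p y].

(* A linear functional below [cone_inf T p] is below [p] and is at least [s] at
   [y] for every [(y, s)] in [T]. *)
Definition cone_inf T p x : R := inf [set p (x + z.1) - z.2 | z in T].

Lemma sublinear0 p : sublinear p -> p 0 = 0.
Proof. by move=> [_ pZ]; rewrite -(scale0r 0) pZ// mul0r. Qed.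

Lemma sublinear_ge p x : sublinear p -> - p (- x) <= p x.
Proof.
move=> ps; have [pD _] := ps.
by rewrite -subr_ge0 opprK (le_trans _ (pD _ _))// subrr sublinear0.
Qed.

Lemma cone_inf_lb T p x : sublinear p -> cone_below T p ->
  lbound [set p (x + z.1) - z.2 | z in T] (- p (- x)).
Proof.
move=> [pD _] [_ _ _ Tp] _ [[y s] /= /Tp sp <-].
rewrite lerBrDr (le_trans (lerD (lexx _) sp))// addrC lerBlDr.
by rewrite (le_trans _ (pD _ _))// addrAC subrr add0r.
Qed.

Lemma cone_inf_le T p x y s : sublinear p -> cone_below T p -> T (y, s) ->
  cone_inf T p x <= p (x + y) - s.
Proof.
move=> ps Tp Tys; apply: ge_inf; last by exists (y, s).
by exists (- p (- x)); exact: cone_inf_lb.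
Qed.

Lemma cone_inf_ge T p x m : cone_below T p ->
  (forall y s, T (y, s) -> m <= p (x + y) - s) -> m <= cone_inf T p x.
Proof.
move=> [T0 _ _ _] Tm; apply: lb_le_inf; first by exists (p (x + 0) - 0), (0, 0).
by move=> _ [[y s] /= /Tm Tys <-].
Qed.

Lemma sublinearP p : (forall x y, p (x + y) <= p x + p y) ->
  (forall (a : R) x, 0 < a -> p (a *: x) <= a * p x) -> p 0 = 0 -> sublinear p.
Proof.
move=> pD pZ p0; split=> // a x; rewrite le_eqVlt => /predU1P[<-|a0].
  by rewrite scale0r p0 mul0r.
apply/le_anti; rewrite pZ//= -ler_pdivlMl//.
have := pZ a^-1 (a *: x); rewrite invr_gt0 => /(_ a0).
by rewrite scalerA mulVf ?gt_eqF// scale1r.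
Qed.

Lemma cone_inf_sublinear T p : sublinear p -> cone_below T p ->
  sublinear (cone_inf T p).
Proof.
move=> ps Tp; have [pD pZ] := ps; have [T0 TD TZ Tle] := Tp.
apply: sublinearP => [x y|a x a0|].
- rewrite -lerBlDr; apply: cone_inf_ge => // u s us.
  rewrite lerBlDr [leRHS]addrC -lerBlDr; apply: cone_inf_ge => // v t vt.
  rewrite lerBlDr (le_trans (cone_inf_le (x + y) ps Tp (TD _ _ _ _ us vt)))//.
  by have := pD (x + u) (y + v); rewrite addrACA; lra.
- rewrite -ler_pdivrMl//; apply: cone_inf_ge => // u s us.
  rewrite ler_pdivrMl// mulrBr -pZ ?(ltW a0)// scalerDr.
  by rewrite cone_inf_le//; apply: TZ => //; exact: ltW.
- apply/le_anti/andP; split.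
    by rewrite (le_trans (cone_inf_le 0 ps Tp T0))// addr0 (sublinear0 ps) subr0.
  by apply: cone_inf_ge => // y s /Tle; rewrite add0r subr_ge0.
Qed.

Definition ray_cone p z : set (V * R) :=
  [set w | exists2 t, 0 <= t & w = (t *: z, t * p z)].

Lemma ray_cone_below p z : sublinear p -> cone_below (ray_cone p z) p.
Proof.
move=> [_ pZ]; split; first by exists 0 => //; rewrite scale0r mul0r.
- move=> _ _ _ _ [s s0 [-> ->]] [t t0 [-> ->]]; exists (s + t).
    exact: addr_ge0.
  by rewrite scalerDl mulrDl.
- move=> b _ _ b0 [s s0 [-> ->]]; exists (b * s); first exact: mulr_ge0.
  by rewrite scalerA mulrA.
- by move=> _ _ [s s0 [-> ->]]; rewrite pZ.
Qed.

Lemma minimal_sublinear p : sublinear p -> exists q, [/\ sublinear q,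
  forall x, q x <= p x &
  forall q', sublinear q' -> (forall x, q' x <= q x) -> q' = q].
Proof.
move=> ps.
pose S := {q : V -> R | sublinear q /\ forall x, q x <= p x}.
pose below (q q' : S) := `[< forall x, sval q' x <= sval q x >].
(* A lower bound common to all of [S], so that pointwise infima over chains are genuine infima. *)
have sval_ge (q : S) x : - p (- x) <= sval q x.
  have [qs qp] := svalP q.
  by rewrite (le_trans _ (sublinear_ge x qs))// lerN2.
have [|||q qmin] := @ZL_preorder S (exist _ p (conj ps (fun=> lexx _))) below.
- by move=> q; apply/asboolP.
- move=> q1 q2 q3 /asboolP h1 /asboolP h2; apply/asboolP => x.
  exact: le_trans (h2 x) (h1 x).
- move=> A Atot; have [[q0 Aq0]|A0] := pselect (exists q : S, A q); last first.
    exists (exist _ p (conj ps (fun=> lexx _))) => q Aq.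
    by exfalso; apply: A0; exists q.
  pose m x := inf [set sval (q : S) x | q in A].
  have m_le (q : S) x : A q -> m x <= sval q x.
    move=> Aq; apply: ge_inf; last by exists q.
    by exists (- p (- x)) => _ [q' _ <-].
  have m_ge x l : (forall q : S, A q -> l <= sval q x) -> l <= m x.
    move=> Al; apply: lb_le_inf; first by exists (sval q0 x), q0.
    by move=> _ [q Aq <-]; exact: Al.
  have msub : sublinear m.
    apply: sublinearP => [x y|a x a0|].
    - rewrite -lerBlDr; apply: (m_ge) => q Aq.
      rewrite lerBlDr [leRHS]addrC -lerBlDr.
      apply: (m_ge) => q' Aq'; rewrite lerBlDr.
      (* Members of a chain are comparable, so subadditivity of the smaller one bounds the mixed sum
         of [q] at one point and [q'] at the other. *)
      wlog qq' : q q' Aq Aq' x y / below q q'.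
        move=> wl; have [|qq'] := Atot _ _ Aq Aq'; first exact: wl.
        by rewrite addrC [leRHS]addrC; apply: wl.
      rewrite (le_trans (m_le q' _ Aq'))// (le_trans ((svalP q').1.1 _ _))//.
      by rewrite addrC lerD2l; move/asboolP : qq'; exact.
    - rewrite -ler_pdivrMl//; apply: (m_ge) => q Aq; rewrite ler_pdivrMl//.
      by rewrite -((svalP q).1.2) ?(ltW a0)// m_le.
    - apply/le_anti/andP; split.
        by rewrite (le_trans (m_le q0 _ Aq0))// (sublinear0 (svalP q0).1).
      by apply: (m_ge) => q _; rewrite (sublinear0 (svalP q).1).
  have mp x : m x <= p x by rewrite (le_trans (m_le q0 _ Aq0))// (svalP q0).2.
  by exists (exist _ m (conj msub mp)) => q Aq; apply/asboolP => x; exact: m_le.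
have [qs qp] := svalP q; exists (sval q); split => // q' q's q'q.
have q'p x : q' x <= p x by rewrite (le_trans (q'q x)).
apply/funext => x; apply/le_anti; rewrite q'q/=.
have /asboolP/(_ x) := qmin (exist _ q' (conj q's q'p)) (introT (asboolP _) q'q).
exact.
Qed.

(** A minimal sublinear [q] is linear: [cone_inf] over the ray through [a] lies below [q], hence
    equals it, and its value at [- a] is at most [- q a]. Oddness upgrades subadditivity to
    additivity. *)
Theorem sublinear_dominated_linear p : sublinear p ->
  exists2 f : V -> R^o, linear f & forall x, f x <= p x.
Proof.
move=> ps; have [q [qs qp qmin]] := minimal_sublinear ps.
have [qD qZ] := qs; exists q => //.
have qN a : q (- a) = - q a.
  pose T := ray_cone q a; have Tq : cone_below T q by exact: ray_cone_below.
  have Tinf : cone_inf T q = q.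
    apply: qmin => [|x]; first exact: cone_inf_sublinear.
    have [T0 _ _ _] := Tq.
    by rewrite (le_trans (cone_inf_le x qs Tq T0))// addr0 subr0.
  apply/le_anti/andP; split; last by rewrite lerNl sublinear_ge.
  have Ta : T (a, q a) by exists 1; rewrite ?scale1r ?mul1r.
  rewrite -[in leLHS]Tinf (le_trans (cone_inf_le _ qs Tq Ta))//.
  by rewrite addNr sublinear0// sub0r.
have qD' x y : q (x + y) = q x + q y.
  apply/le_anti; rewrite qD/= -lerBrDr -qN.
  by rewrite (le_trans _ (qD _ _))// addrK.
move=> a x y; rewrite qD'; congr (_ + _).
have [a0|/ltW a0] := leP 0 a; first exact: qZ.
have := qZ (- a) x; rewrite oppr_ge0 => /(_ a0).
by rewrite scaleNr qN mulNr => /oppr_inj.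
Qed.

(** The Mazur-Orlicz form of Hahn-Banach: norming functionals and separation of convex sets are both
    obtained by a choice of the cone [T]. *)
Theorem cone_dominated_linear T p : sublinear p -> cone_below T p ->
  exists f : V -> R^o, [/\ linear f, forall x, f x <= p x &
    forall y s, T (y, s) -> s <= f y].
Proof.
move=> ps Tp; have [T0 _ _ _] := Tp.
have [f lf fle] := sublinear_dominated_linear (cone_inf_sublinear ps Tp).
exists f; split => // [x|y s Tys].
  rewrite (le_trans (fle x))// (le_trans (cone_inf_le x ps Tp T0))//.
  by rewrite addr0 subr0.
rewrite -lerN2 -(linear_combN lf) (le_trans (fle _))//.
rewrite (le_trans (cone_inf_le _ ps Tp Tys))//.
by rewrite addNr sublinear0// sub0r.
Qed.

Lemma sublinear_norming p z : sublinear p ->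
  exists f : V -> R^o, [/\ linear f, forall x, f x <= p x & f z = p z].
Proof.
move=> ps; have [f [lf fp fT]] := cone_dominated_linear ps (ray_cone_below z ps).
exists f; split => //; apply/le_anti; rewrite fp/=; apply: fT.
by exists 1; rewrite ?scale1r ?mul1r.
Qed.

End SublinearFunctionals.

(** * Limits along an ultrafilter *)

Section Ultralimits.
Variables (R : realType) (U : set_system nat).
Hypothesis UU : UltraFilter U.
Implicit Types (u v : nat -> R).

Definition bnd u := exists M, forall n, `|u n| <= M.

(* Junk for unbounded [u]. *)
Definition ulim u : R := lim (u n @[n --> U]).

Lemma bnd_cst (a : R) : bnd (fun=> a).
Proof. by exists `|a|. Qed.

Lemma bndD u v : bnd u -> bnd v -> bnd (fun n => u n + v n).
Proof.
move=> [M uM] [M' vM']; exists (M + M') => n.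
by rewrite (le_trans (ler_normD _ _))// lerD.
Qed.

Lemma bndZ (a : R) u : bnd u -> bnd (fun n => a * u n).
Proof. by move=> [M uM]; exists (`|a| * M) => n; rewrite normrM ler_wpM2l. Qed.

Lemma ulim_cvg u : bnd u -> u n @[n --> U] --> ulim u.
Proof.
move=> [M uM]; suff [l ul] : exists l : R, u n @[n --> U] --> l.
  exact: (cvgP l ul).
have [|l [_ lu]] := @segment_compact R (- M) M (u n @[n --> U]) _.
  apply: (@filterE _ U) => n /=.
  by have := uM n; rewrite ler_norml in_itv.
exists l => V Vl; have [//|UVC] := in_ultra_setVsetC (u @^-1` V) UU.
have [y [+ Vy]] := lu (~` V) V UVC Vl.
by move=> /(_ Vy).
Qed.

Lemma ulim_eq u (l : R) : u n @[n --> U] --> l -> ulim u = l.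
Proof. by move=> ul; apply: (cvg_lim (@norm_hausdorff _ _) ul). Qed.

Lemma ulim_cst (a : R) : ulim (fun=> a) = a.
Proof. by apply: ulim_eq; exact: cvg_cst. Qed.

Lemma ulimD u v : bnd u -> bnd v -> ulim (fun n => u n + v n) = ulim u + ulim v.
Proof. by move=> bu bv; apply: ulim_eq; apply: cvgD; exact: ulim_cvg. Qed.

Lemma ulimZ (a : R) u : bnd u -> ulim (fun n => a * u n) = a * ulim u.
Proof. by move=> bu; apply: ulim_eq; apply: cvgMr; exact: ulim_cvg. Qed.

Lemma le_ulim u v : bnd u -> bnd v -> (\forall n \near U, u n <= v n) ->
  ulim u <= ulim v.
Proof. by move=> bu bv uv; apply: ler_lim => //; apply: cvgP; exact: ulim_cvg. Qed.

Lemma ulim_le u v : bnd u -> bnd v -> (forall n, u n <= v n) -> ulim u <= ulim v.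
Proof. by move=> bu bv uv; apply: le_ulim => //; exact: filterE. Qed.

Lemma ulim_ge_cst (a : R) u : bnd u -> (forall n, a <= u n) -> a <= ulim u.
Proof. by move=> bu au; rewrite -(ulim_cst a) ulim_le//; exact: bnd_cst. Qed.

Lemma ulim_le_cst (a : R) u : bnd u -> (forall n, u n <= a) -> ulim u <= a.
Proof. by move=> bu au; rewrite -(ulim_cst a) ulim_le//; exact: bnd_cst. Qed.

Lemma ulim_lt_near u (a : R) : bnd u -> ulim u < a -> \forall n \near U, u n < a.
Proof. by move=> bu ua; apply: cvgr_lt ua; exact: ulim_cvg. Qed.

Lemma ulim_gt_near u (a : R) : bnd u -> a < ulim u -> \forall n \near U, a < u n.
Proof. by move=> bu ua; apply: cvgr_gt ua; exact: ulim_cvg. Qed.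

Lemma bnd_ulim (w : nat -> nat -> R) M : (forall m n, `|w m n| <= M) ->
  bnd (fun m => ulim (w m)).
Proof.
move=> wM; have bw m : bnd (w m) by exists M.
exists M => m; rewrite ler_norml ulim_ge_cst ?ulim_le_cst//.
  by move=> n; have := wM m n; rewrite ler_norml => /andP[].
by move=> n; have := wM m n; rewrite ler_norml => /andP[].
Qed.

Hypothesis cofU : \oo `<=` U.

Lemma cvg_ulim u (l : R) : u n @[n --> \oo] --> l -> ulim u = l.
Proof. by move=> ul; apply: ulim_eq; apply: cvg_trans ul => V; exact: cofU. Qed.

Lemma bnd_cvgn u : cvgn u -> bnd u.
Proof.
move=> /cvg_seq_bounded [M [_ /(_ (M + 1))]]; rewrite ltrDl => /(_ ltr01) uM.
by exists (M + 1) => n; exact: uM.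
Qed.

Lemma ex_iterated_lim_ulim (w : nat -> nat -> R) : ex_iterated_lim w ->
  iterated_lim w = ulim (fun m => ulim (w m)).
Proof.
move=> [wc wcc]; rewrite (@cvg_ulim _ (limn (fun m => limn (w m))))//.
have -> // : (fun m => ulim (w m)) = (fun m => limn (w m)).
by apply/funext => m; apply: cvg_ulim; exact: wc.
Qed.

End Ultralimits.

(** * Separation and weak limits *)

Section BoundedFunctionals.
Variables (R : realType) (V : normedModType R).

Definition bound_functional (f : V -> R^o) (C : R) :=
  linear f /\ forall x, `|f x| <= C * `|x|.

Lemma bounded_functional_dual (f : V -> R^o) C : bound_functional f C ->
  exists g : dual V, forall x, g x = f x.
Proof.
move=> [lf fC].
pose fl : {linear V -> R^o} := HB.pack f (GRing.isLinear.Build _ _ _ _ _ lf).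
suff fP : f \in @dual_pred R V by exists (Dual fP).
rewrite inE; split => //; apply: (linear_bounded_continuous fl).1.
apply/linear_boundedP; exists C; split; first exact: num_real.
by move=> r /ltW Cr x; rewrite (le_trans (fC x))// ler_wpM2r.
Qed.

Lemma dual_le (f : dual V) x : `|f x| <= `|f| * `|x|.
Proof.
have [lf _] := dualP f; have [->|x0] := eqVneq x 0.
  by rewrite (linear_comb0 lf) !normr0 mulr0.
have nx0 : 0 < `|x| by rewrite normr_gt0.
have /(dual_norm_ub f) : `| `|x|^-1 *: x| <= 1.
  by rewrite normrZ normfV normr_id mulVf ?gt_eqF.
rewrite (linear_combZ lf) normrM normfV normr_id -dual_normE.
by rewrite ler_pdivrMl// mulrC.
Qed.

Lemma le_norm_bound_functional (f : V -> R^o) (C : R) : linear f ->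
  (forall x, f x <= C * `|x|) -> bound_functional f C.
Proof.
move=> lf fC; split => // x; rewrite ler_norml fC andbT lerNl.
by rewrite -(linear_combN lf) -[in leRHS]normrN.
Qed.

Lemma norm_sublinear : sublinear (fun x : V => `|x| : R).
Proof. by split; [exact: ler_normD|move=> a x a0; rewrite normrZ ger0_norm]. Qed.

Definition convex_cone_at (C : set V) (z : V) (e : R) : set (V * R) :=
  [set w | exists s v, [/\ 0 <= s, C v & w = (s *: (v - z), s * e)]].

Definition is_convex (W : lmodType R) (C : set W) := forall (a : R) v w,
  0 <= a <= 1 -> C v -> C w -> C (a *: v + (1 - a) *: w).

(** The distance bound says exactly that the cone generated by the pairs [(v - z, e)] lies below the
    norm, and convexity of [C] closes this cone under sums. The gap [e] is thus attained by a
    functional of norm at most one. *)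
Lemma convex_separation (C : set V) (z : V) (e : R) : is_convex C ->
  C !=set0 -> (forall v, C v -> e <= `|v - z|) ->
  exists f : V -> R^o, bound_functional f 1 /\ forall v, C v -> f z + e <= f v.
Proof.
move=> cC [v0 Cv0] Ce.
have [|f [lf f1 fC]] := @cone_dominated_linear R V
    (convex_cone_at C z e) _ norm_sublinear.
  split.
  - by exists 0, v0; rewrite scale0r mul0r.
  - move=> _ _ _ _ [s [v [s0 Cv [-> ->]]]] [t [w [t0 Cw [-> ->]]]].
    have [st0|st0] := eqVneq (s + t) 0.
      have [-> ->] : s = 0 /\ t = 0 by split; lra.
      by exists 0, v0; rewrite !scale0r !mul0r !addr0.
    have st : 0 < s + t by rewrite lt_neqAle eq_sym st0 addr_ge0.
    exists (s + t), ((s / (s + t)) *: v + (1 - s / (s + t)) *: w); split.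
    + exact: ltW.
    + by apply: cC => //; rewrite divr_ge0 ?(ltW st)//= ler_pdivrMr// mul1r lerDl.
    + congr (_, _); last by rewrite mulrDl.
      have -> : 1 - s / (s + t) = t / (s + t) by field.
      rewrite [RHS]scalerBr [in RHS]scalerDr !scalerA !(mulrCA (s + t)) divff// !mulr1.
      by rewrite !scalerBr scalerDl opprD addrACA.
  - move=> a _ _ a0 [s [v [s0 Cv [-> ->]]]]; exists (a * s), v; split => //.
      exact: mulr_ge0.
    by rewrite scalerA mulrA.
  - move=> _ _ [s [v [s0 Cv [-> ->]]]]; rewrite normrZ ger0_norm//.
    by rewrite ler_wpM2l// Ce.
exists f; split.
  by apply: le_norm_bound_functional => // x; rewrite mul1r.
move=> v Cv; have /fC : convex_cone_at C z e (v - z, e).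
  by exists 1, v; rewrite scale1r mul1r.
by rewrite (linear_combD lf) (linear_combN lf) lerBrDl.
Qed.

End BoundedFunctionals.

Section WeakLimits.
Variables (R : realType) (X : normedModType R) (U : set_system nat).
Hypothesis UU : UltraFilter U.

Definition weak_ulim (u : nat -> X) (z : X) :=
  forall f : X -> R^o, bound_functional f 1 -> ulim U (fun n => f (u n)) = f z.

Lemma bound_functional_bnd (V : normedModType R) (f : V -> R^o) C (u : nat -> V) :
  bound_functional f C -> bnd (fun n => `|u n|) -> bnd (fun n => f (u n)).
Proof.
move=> [_ fC] [M uM]; exists (`|C| * M) => n; rewrite (le_trans (fC _))//.
rewrite (le_trans (ler_norm _))// normrM normr_id ler_wpM2l//.
by rewrite (le_trans _ (uM n))// normr_id.
Qed.

(** Taking the ultralimit of [f (v n)] is a bounded linear operation on the dual of [Y]; reflexivity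
    represents it by a point. Functionals on [X] are tested through their restrictions to [Y]. *)
Lemma reflexive_weak_ulim (Y : submodClosed X) (u : nat -> X) :
  reflexive_space (sublmod Y) -> (forall n, u n \in Y) ->
  bnd (fun n => `|u n|) -> exists z, weak_ulim u z.
Proof.
move=> reflY uY bu; have [M uM] := bu.
pose v n : sublmod Y := Sublmod (uY n).
have bv (f : dual (sublmod Y)) : bnd (fun n => f (v n)).
  exists (`|f| * M) => n; rewrite (le_trans (dual_le _ _))// ler_wpM2l//.
  by rewrite (le_trans _ (uM n))// normr_id.
have [|Phi PhiE] := @bounded_functional_dual R (dual (sublmod Y))
    (fun f => ulim U (fun n => f (v n))) M.
  split.
    move=> a f g; change (ulim U (fun n => a * f (v n) + g (v n)) =
      a * ulim U (fun n => f (v n)) + ulim U (fun n => g (v n))).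
    by rewrite ulimD// ?ulimZ//; exact: bndZ.
  move=> f; rewrite ler_norml.
  have fM n : `|f (v n)| <= M * `|f|.
    rewrite (le_trans (dual_le _ _))// mulrC ler_wpM2r//.
    by rewrite (le_trans _ (uM n))// normr_id.
  rewrite ulim_ge_cst ?ulim_le_cst// => n.
    by have := fM n; rewrite ler_norml => /andP[].
  by have := fM n; rewrite ler_norml => /andP[].
have [z zP] := reflY Phi; exists (val z) => f [lf f1].
have [|g gE] := @bounded_functional_dual R (sublmod Y) (fun y => f (val y)) 1.
  split => [a x y|y]; last exact: f1.
  by rewrite -lf linearP.
by have := zP g; rewrite PhiE gE => <-; congr ulim; apply/funext => n; rewrite gE.
Qed.

(** If [C] stayed at distance [e] from [z], a separating functional would be at least [f z + e] on
    [U]-almost all [u n], hence also in the limit. *)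
Lemma mazur (u : nat -> X) (z : X) (C : set X) (e : R) :
  weak_ulim u z -> bnd (fun n => `|u n|) ->
  is_convex C -> (\forall n \near U, C (u n)) -> 0 < e ->
  exists2 v, C v & `|v - z| < e.
Proof.
move=> uz bu cC UC e0; apply: contrapT => nC.
have Ce v : C v -> e <= `|v - z|.
  by move=> Cv; rewrite leNgt; apply/negP => ve; apply: nC; exists v.
have [n0 Cn0] := filter_ex UC.
have [|f [f1 fC]] := convex_separation cC _ Ce; first by exists (u n0).
have := uz _ f1; apply/eqP; rewrite gt_eqF// (@lt_le_trans _ _ (f z + e))//.
  by rewrite ltrDl.
rewrite -[leLHS](ulim_cst UU) le_ulim//; first exact: bnd_cst.
  exact: bound_functional_bnd f1 bu.
by apply: filterS UC => n; exact: fC.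
Qed.

(* Both convex families meet every ball around the weak limit, along different
   indices. *)
Lemma james_close_convex (Y : submodClosed X) (u : nat -> X)
    (A B : nat -> set X) (e : R) :
  \oo `<=` U ->
  reflexive_space (sublmod Y) -> (forall n, u n \in Y) ->
  bnd (fun n => `|u n|) ->
  (forall k, is_convex (A k)) -> (forall k, A k `<=` A k.+1) ->
  (forall k, A k.+1 (u k)) ->
  (forall k, is_convex (B k)) -> (forall k n, (k <= n)%N -> B k (u n)) ->
  0 < e -> exists k v w, [/\ A k v, B k w & `|v - w| < e].
Proof.
move=> cofU reflY uY bu cA Ainc Au cB Bu e0.
have [z uz] := reflexive_weak_ulim reflY uY bu.
have Amono k l : (k <= l)%N -> A k `<=` A l.
  by move=> kl; elim: l kl => [|l IH]; [rewrite leqn0 => /eqP ->|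
    rewrite leq_eqVlt ltnS => /predU1P[->//|/IH kl x /kl/Ainc]].
have e20 : 0 < e / 2 by rewrite divr_gt0.
have [||v [k _ Akv] vz] := mazur uz bu _ _ e20 (C := \bigcup_k A k).
- move=> a v w a01 [k _ Akv] [l _ Alw]; exists (maxn k l) => //.
  by apply: cA => //; [apply: Amono Akv; exact: leq_maxl|
    apply: Amono Alw; exact: leq_maxr].
- by apply: (@filterE _ U) => n; exists n.+1.
have [|w Bw wz] := mazur uz bu (cB k) _ e20.
  by apply: cofU; exists k => // n /= kn; exact: Bu.
exists k, v, w; split => //; rewrite [e]splitr.
by rewrite (le_lt_trans (ler_distD z _ _))// ltrD// distrC.
Qed.

End WeakLimits.

(** * The equivalent norm *)

Section RenormingBuildingBlocks.
Variables (R : realType) (X : normedModType R).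
Implicit Types (p r : X -> R).

Definition dominated_seminorm p :=
  [/\ forall x y, p (x + y) <= p x + p y,
      forall (a : R) x, p (a *: x) = `|a| * p x &
      exists C, forall x, p x <= C * `|x|].

Lemma norm_seminorm : dominated_seminorm (fun x : X => `|x| : R).
Proof.
by split; [exact: ler_normD|exact: normrZ|exists 1 => x; rewrite mul1r].
Qed.

Lemma seminorm_ge0 p x : dominated_seminorm p -> 0 <= p x.
Proof.
move=> [pD pZ _]; have p0 : p 0 = 0 by rewrite -(scale0r 0) pZ normr0 mul0r.
have := pD x (- x); rewrite subrr p0 -scaleN1r pZ normrN1 mul1r -mulr2n.
by rewrite pmulrn_lge0.
Qed.

Lemma seminormN p x : dominated_seminorm p -> p (- x) = p x.
Proof. by move=> [_ pZ _]; rewrite -scaleN1r pZ normrN1 mul1r. Qed.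

Lemma seminormZ p a x : dominated_seminorm p -> 0 <= a -> p (a *: x) = a * p x.
Proof. by move=> [_ pZ _] a0; rewrite pZ ger0_norm. Qed.

Lemma seminorm_dist p (x y : X) : dominated_seminorm p ->
  `|p x - p y| <= p (x - y).
Proof.
move=> ps; have [pD _ _] := ps; rewrite ler_norml.
have := pD (x - y) y; have := pD (y - x) x; rewrite !subrK.
by rewrite -(opprB x) seminormN// => ? ?; apply/andP; lra.
Qed.

Lemma seminorm_cvg p (F : set_system nat) (x : nat -> X) (z : X) : Filter F ->
  dominated_seminorm p -> x n @[n --> F] --> z -> p (x n) @[n --> F] --> p z.
Proof.
move=> FF ps xz; have [_ _ [C pC]] := ps.
apply/cvgrPdist_le => e e0.
have d0 : 0 < e / (`|C| + 1) by rewrite divr_gt0// ltr_wpDl.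
move/cvgrPdist_le : xz => /(_ _ d0); apply: filterS => n zx.
rewrite (le_trans (seminorm_dist _ _ ps))// (le_trans (pC _))//.
rewrite (@le_trans _ _ ((`|C| + 1) * `|z - x n|))//.
  by rewrite ler_wpM2r// (le_trans (ler_norm _))// lerDl.
by rewrite mulrC -ler_pdivlMr// ltr_wpDl.
Qed.

(* Since [t |-> `|t *: c + x| + `|t *: c - x|] is even and convex, it is
   nondecreasing on t >= 0; this makes [tilted_norm c] subadditive. *)
Definition tilted_norm (c x : X) : R :=
  `| `|x| *: c + x| + `| `|x| *: c - x|.

Lemma tilt_mono (c x : X) (s t : R) : 0 <= s <= t ->
  `|s *: c + x| + `|s *: c - x| <= `|t *: c + x| + `|t *: c - x|.
Proof.
move=> /andP[s0 st]; have [t0|t0] := leP t 0.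
  by have -> : s = t by lra.
(* Chosen so that [a + b = 1] and [(a - b) * t = s]: then [s *: c + x] is a convex combination of
   [t *: c + x] and of minus [t *: c - x], and symmetrically. *)
pose a := (1 + s / t) / 2; pose b := (1 - s / t) / 2.
have st1 : s / t <= 1 by rewrite ler_pdivrMr// mul1r.
have st0 : 0 <= s / t by rewrite divr_ge0// ltW.
have a0 : 0 <= a by rewrite /a; lra.
have b0 : 0 <= b by rewrite /b; lra.
have ab1 : a + b = 1 by rewrite /a /b; lra.
have abt : (a - b) * t = s by rewrite /a /b; field; rewrite gt_eqF.
clearbody a b.
have E1 : s *: c + x = a *: (t *: c + x) + b *: (- (t *: c - x)).
  rewrite opprB (addrC x) !scalerDr scalerN !scalerA addrACA -scalerBl -mulrBl.
  rewrite abt.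
  by rewrite -scalerDl ab1 scale1r.
have E2 : s *: c - x = a *: (t *: c - x) + b *: (- (t *: c + x)).
  rewrite opprD !scalerDr !scalerN !scalerA addrACA -scalerBl -mulrBl abt.
  by rewrite -opprD -scalerDl ab1 scale1r.
have L1 := ler_normD (a *: (t *: c + x)) (b *: (- (t *: c - x))).
have L2 := ler_normD (a *: (t *: c - x)) (b *: (- (t *: c + x))).
rewrite -E1 !normrZ normrN (ger0_norm a0) (ger0_norm b0) in L1.
rewrite -E2 !normrZ normrN (ger0_norm a0) (ger0_norm b0) in L2.
have bE : b = 1 - a by lra.
rewrite {}bE in L1 L2.
by move: L1 L2; move: `|s *: _ + _| `|s *: _ - _| `|t *: _ + _| `|t *: _ - _|;
  move=> *; nra.
Qed.

Lemma tilted_norm_seminorm c : dominated_seminorm (tilted_norm c).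
Proof.
split.
- move=> x y; rewrite /tilted_norm.
  rewrite (le_trans (@tilt_mono c (x + y) _ (`|x| + `|y|) _))//.
    by rewrite normr_ge0 ler_normD.
  rewrite scalerDl addrACA opprD [X in _ + `|X|]addrACA.
  have := ler_normD (`|x| *: c + x) (`|y| *: c + y).
  have := ler_normD (`|x| *: c - x) (`|y| *: c - y).
  by lra.
- move=> a x; rewrite /tilted_norm normrZ -!scalerA mulrDr.
  have [a0|/ltW a0] := leP 0 a.
    by rewrite ger0_norm// -scalerDr -scalerBr !normrZ ger0_norm.
  rewrite ler0_norm// -[a *: x]opprK -scaleNr opprK -scalerBr -scalerDr.
  by rewrite !normrZ normrN ler0_norm// addrC.
- exists (2 * (1 + `|c|)) => x; rewrite /tilted_norm.
  have := ler_normD (`|x| *: c) x; have := ler_normB (`|x| *: c) x.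
  by rewrite normrZ normr_id; lra.
Qed.

Lemma tilted_norm_lb c x : 2 * `|x| <= tilted_norm c x.
Proof.
have := @tilt_mono c x 0 `|x|; rewrite lexx normr_ge0 => /(_ isT).
by rewrite scale0r add0r sub0r normrN /tilted_norm; lra.
Qed.

Lemma tilted_norm_ub c x : tilted_norm c x <= 2 * (1 + `|c|) * `|x|.
Proof.
have := ler_normD (`|x| *: c) x; have := ler_normB (`|x| *: c) x.
by rewrite /tilted_norm normrZ normr_id; lra.
Qed.

Definition dense_seq (c : nat -> X) :=
  forall x (e : R), 0 < e -> exists n, `|x - c n| < e.

Lemma separable_dense_seq : separable_space X -> exists c, dense_seq c.
Proof.
move=> [D cD dD].
have [x0 [_ Dx0]] : [set: X] `&` D !=set0.
  by apply: dD; [exists 0|exact: openT].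
have [f Df] : exists f : nat -> X, forall x, D x -> exists n, f n = x.
  have /countable_injP[g ginj] := cD.
  exists (fun n => xget x0 [set x | D x /\ g x = n]) => x Dx; exists (g x).
  case: xgetP => [y _ [Dy gyx]|/(_ x) []//].
  by apply: ginj; rewrite ?inE.
exists f => x e e0.
have [|y [yx Dy]] := dD (ball x e) _ (ball_open x e).
  by exists x; exact: ballxx.
by have [n fn] := Df _ Dy; exists n; rewrite fn; move: yx; rewrite -ball_normE.
Qed.

Lemma exists_cofinite_ultrafilter :
  exists U : set_system nat, UltraFilter U /\ \oo `<=` U.
Proof. exact: ultraFilterLemma. Qed.

Section InfiniteSum.
Variables (s : nat -> X -> R).
Hypothesis s_semi : forall j, dominated_seminorm (s j).
Hypothesis s_le : forall j x, s j x <= 2^-1 ^+ j * `|x|.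
Variables (U : set_system nat).
Hypothesis (UU : UltraFilter U) (cofU : \oo `<=` U).

Let psum (P : pred nat) x n : R := \sum_(j < n | P j) s j x.

Let psum_ge0 P x n : 0 <= psum P x n.
Proof. by apply: sumr_ge0 => j _; exact: seminorm_ge0. Qed.

Let psum_le P x n : psum P x n <= 2 * `|x|.
Proof.
apply: (@le_trans _ _ (\sum_(j < n) (2^-1 ^+ j * `|x|))).
  rewrite /psum big_mkcond ler_sum// => j _; case: ifP => _; first exact: s_le.
  by rewrite mulr_ge0// exprn_ge0.
rewrite -mulr_suml ler_wpM2r//.
have := @geometric_le_lim R n 1 2^-1 ler01.
rewrite seriesEord/=; under eq_bigr do rewrite mul1r.
have -> : 1 / (1 - 2^-1) = 2 :> R by field.
by apply; [rewrite invr_gt0|rewrite ger0_norm ?invr_ge0// invf_lt1 ?ltr1n].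
Qed.

Let psum_bnd P x : bnd (psum P x).
Proof.
by exists (2 * `|x|) => n; rewrite ger0_norm.
Qed.

(** The partial sums increase and are bounded, so this is the ordinary sum. The predicate allows one
    summand to be split off while the rest is again a dominated seminorm. *)
Definition seminorm_sum (P : pred nat) x : R := ulim U (psum P x).

Lemma seminorm_sum_seminorm P : dominated_seminorm (seminorm_sum P).
Proof.
split => [x y|a x|].
- rewrite -ulimD// ulim_le//; first exact: bndD.
  move=> n; rewrite -big_split/= ler_sum// => j _; by have [sD _ _] := s_semi j.
- rewrite -ulimZ//; congr ulim; apply/funext => n.
  by rewrite /psum mulr_sumr; apply: eq_bigr => j _; have [_ sZ _] := s_semi j.
- by exists 2 => x; rewrite ulim_le_cst.
Qed.

Lemma seminorm_sumD1 k x :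
  seminorm_sum predT x = s k x + seminorm_sum (fun j => j != k) x.
Proof.
rewrite -[s k x](ulim_cst UU) -ulimD//; last exact: bnd_cst.
apply: (ulim_eq UU); have b := bndD (bnd_cst (s k x)) (psum_bnd (fun j => j != k) x).
apply: cvg_trans (ulim_cvg UU b).
apply: near_eq_cvg; apply: cofU; exists k.+1 => // n /= kn.
by rewrite /psum [in RHS](bigD1 (Ordinal kn)).
Qed.

End InfiniteSum.

Lemma odell_schlumprecht_norm : separable_space X ->
  exists2 N : X -> R, equivalent_norm N &
    dominated_seminorm N /\
    exists2 c : nat -> X, dense_seq c &
      forall k, exists (a : R) (r : X -> R), [/\ 0 < a, dominated_seminorm r &
        forall x, N x = a * tilted_norm (c k) x + r x].
Proof.
move=> /separable_dense_seq[c cd].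
have [U [UU cofU]] := exists_cofinite_ultrafilter.
(* The denominator is the constant of [tilted_norm_ub], which makes the [j]-th summand at most
   [2^-1 ^+ j] times the norm. *)
pose w j : R := 2^-1 ^+ j / (2 * (1 + `|c j|)).
have c0 j : 0 < 2 * (1 + `|c j|) by rewrite mulr_gt0// ltr_pwDl.
have w0 j : 0 < w j by rewrite divr_gt0// exprn_gt0// invr_gt0.
pose s j x := w j * tilted_norm (c j) x.
have ss j : dominated_seminorm (s j).
  have [tD tZ _] := tilted_norm_seminorm (c j); split => [x y|a x|].
  - by rewrite /s -mulrDr ler_wpM2l// ltW.
  - by rewrite /s tZ mulrCA.
  - exists (w j * (2 * (1 + `|c j|))) => x.
    by rewrite /s -[leRHS]mulrA ler_wpM2l ?(ltW (w0 j))// tilted_norm_ub.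
have sle j x : s j x <= 2^-1 ^+ j * `|x|.
  rewrite /s /w mulrAC ler_pdivrMr// -mulrA ler_wpM2l ?exprn_ge0//.
  by rewrite [leRHS]mulrC tilted_norm_ub.
have sumS := seminorm_sum_seminorm ss sle UU.
have sumE := seminorm_sumD1 ss sle UU cofU.
exists (seminorm_sum s U predT).
  have lb x : 2 * w 0 * `|x| <= seminorm_sum s U predT x.
    rewrite (sumE 0%N) (@le_trans _ _ (s 0%N x))//.
      by rewrite /s mulrAC mulrC ler_wpM2l ?(ltW (w0 _))// tilted_norm_lb.
    by rewrite lerDl seminorm_ge0.
  have [SD SZ [C SC]] := sumS predT; split => //.
    move=> x Sx; have := lb x; rewrite Sx => h; apply/eqP.
    by rewrite -normr_le0 -(pmulr_rle0 _ (_ : 0 < 2 * w 0)) ?mulr_gt0.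
  exists (2 * w 0), (`|C| + 1); split; [exact: mulr_gt0|exact: ltr_wpDl|].
  move=> x; rewrite lb/= (le_trans (SC x))// ler_wpM2r//.
  by rewrite (le_trans (ler_norm _))// lerDl.
split => //; exists c => // k.
by exists (w k), (seminorm_sum s U (fun j => j != k)); split => // x; exact: sumE.
Qed.

End RenormingBuildingBlocks.

(** * Iterated ultralimits and extremal equalities *)

Section IteratedUltralimits.
Variables (R : realType) (U : set_system nat).
Hypothesis UU : UltraFilter U.
Implicit Types (v w : nat -> nat -> R).

Definition bnd2 w := exists M, forall m n, `|w m n| <= M.

Definition ulim2 w : R := ulim U (fun m => ulim U (w m)).

Lemma bnd2_bnd w m : bnd2 w -> bnd (w m).
Proof. by move=> [M wM]; exists M. Qed.

Lemma bnd2_ulim w : bnd2 w -> bnd (fun m => ulim U (w m)).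
Proof. by move=> [M wM]; exact: (bnd_ulim UU wM). Qed.

Lemma bnd2D v w : bnd2 v -> bnd2 w -> bnd2 (fun m n => v m n + w m n).
Proof.
move=> [M vM] [M' wM']; exists (M + M') => m n.
by rewrite (le_trans (ler_normD _ _))// lerD.
Qed.

Lemma bnd2Z (a : R) w : bnd2 w -> bnd2 (fun m n => a * w m n).
Proof. by move=> [M wM]; exists (`|a| * M) => m n; rewrite normrM ler_wpM2l. Qed.

Lemma ulim2D v w : bnd2 v -> bnd2 w ->
  ulim2 (fun m n => v m n + w m n) = ulim2 v + ulim2 w.
Proof.
move=> bv bw; rewrite /ulim2 -ulimD; [|exact: bnd2_ulim|exact: bnd2_ulim].
by congr ulim; apply/funext => m; rewrite ulimD//; exact: bnd2_bnd.
Qed.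

Lemma ulim2Z (a : R) w : bnd2 w -> ulim2 (fun m n => a * w m n) = a * ulim2 w.
Proof.
move=> bw; rewrite /ulim2 -ulimZ; [|exact: bnd2_ulim].
by congr ulim; apply/funext => m; rewrite ulimZ//; exact: bnd2_bnd.
Qed.

Lemma ulim2_le v w : bnd2 v -> bnd2 w -> (forall m n, v m n <= w m n) ->
  ulim2 v <= ulim2 w.
Proof.
move=> bv bw vw; apply: (ulim_le UU); [exact: bnd2_ulim|exact: bnd2_ulim|].
by move=> m; apply: (ulim_le UU) => //; exact: bnd2_bnd.
Qed.

Lemma ulim2_fst (u : nat -> R) : ulim2 (fun m _ => u m) = ulim U u.
Proof. by congr ulim; apply/funext => m; rewrite ulim_cst. Qed.

Lemma ulim2_snd (u : nat -> R) : ulim2 (fun _ n => u n) = ulim U u.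
Proof. by rewrite /ulim2 ulim_cst. Qed.

Lemma ulim2_congr v w : (forall m n, v m n = w m n) -> ulim2 v = ulim2 w.
Proof.
by move=> vw; congr ulim2; apply/funext => m; apply/funext => n; exact: vw.
Qed.

Lemma ulim_norm (u : nat -> R) : bnd u -> ulim U (fun n => `|u n|) = `|ulim U u|.
Proof. by move=> bu; apply: (ulim_eq UU); apply: cvg_norm; exact: (ulim_cvg UU). Qed.

Lemma ulim2_norm w : bnd2 w -> ulim2 (fun m n => `|w m n|) = `|ulim2 w|.
Proof.
move=> bw; rewrite /ulim2 -ulim_norm; last exact: bnd2_ulim.
by congr ulim; apply/funext => m; rewrite ulim_norm//; exact: bnd2_bnd.
Qed.

Lemma ulim2_dist_le v w t : bnd2 v -> bnd2 w -> bnd2 t ->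
  (forall m n, `|v m n - w m n| <= t m n) -> `|ulim2 v - ulim2 w| <= ulim2 t.
Proof.
move=> bv bw bt vwt.
have bNw : bnd2 (fun m n => -1 * w m n) by exact: bnd2Z.
have bN : bnd2 (fun m n => v m n + -1 * w m n) by exact: bnd2D.
rewrite -[X in _ - X]mul1r -mulNr -ulim2Z// -ulim2D// -ulim2_norm//.
apply: ulim2_le => //; last by move=> m n; rewrite mulN1r.
by have [M h] := bN; exists M => m n; rewrite normr_id.
Qed.

End IteratedUltralimits.

Section IteratedNorms.
Variables (R : realType) (X : normedModType R) (U : set_system nat).
Hypothesis UU : UltraFilter U.
Implicit Types (v : nat -> nat -> X).

Lemma seminorm_bnd2 p v : dominated_seminorm p -> bnd2 (fun m n => `|v m n| : R) ->
  bnd2 (fun m n => p (v m n) : R).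
Proof.
move=> ps [M vM]; have [_ _ [C pC]] := ps; exists (`|C| * M) => m n.
rewrite ger0_norm ?seminorm_ge0// (le_trans (pC _))//.
rewrite (le_trans (ler_norm _))// normrM normr_id ler_wpM2l//.
by rewrite (le_trans _ (vM m n))// normr_id.
Qed.

Lemma bnd2_normD v (c : X) : bnd2 (fun m n => `|v m n| : R) ->
  bnd2 (fun m n => `|c + v m n| : R).
Proof.
move=> [M vM]; exists (`|c| + M) => m n; rewrite normr_id.
by rewrite (le_trans (ler_normD _ _))// lerD2l (le_trans _ (vM m n))// normr_id.
Qed.

Lemma bnd2_normN v : bnd2 (fun m n => `|v m n| : R) ->
  bnd2 (fun m n => `|- v m n| : R).
Proof. by move=> [M vM]; exists M => m n; rewrite normrN. Qed.

(** Both terms of the tilted norm are Lipschitz in the tilting scalar, and the distance from the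
    norm of [v m n] to [r] has iterated ultralimit 0 because ultralimits commute with absolute
    values. So the scalar may be frozen at [r]. *)
Lemma ulim2_tilted_norm v c : bnd2 (fun m n => `|v m n| : R) ->
  ulim2 U (fun m n => tilted_norm c (v m n)) =
  let r : R := ulim2 U (fun m n => `|v m n|) in
  ulim2 U (fun m n => `|r *: c + v m n|) + ulim2 U (fun m n => `|r *: c - v m n|).
Proof.
move=> bv /=; set r := ulim2 U (fun m n => `|v m n|).
have bNv := bnd2_normN bv.
have b1 := bnd2_normD (r *: c) bv; have b2 := bnd2_normD (r *: c) bNv.
have bt := seminorm_bnd2 (tilted_norm_seminorm c) bv.
have bvr : bnd2 (fun m n => `|v m n| + - r).
  by apply: bnd2D => //; exists `|- r|.
have br : bnd2 (fun m n => `| `|v m n| + - r|).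
  by have [M h] := bvr; exists M => m n; rewrite normr_id.
rewrite -ulim2D//; apply/eqP; rewrite -subr_eq0 -normr_le0.
apply: (@le_trans _ _ (ulim2 U (fun m n => 2 * `|c| * `| `|v m n| + - r|))).
  apply: ulim2_dist_le => //; [exact: bnd2D|exact: bnd2Z|move=> m n].
  rewrite /tilted_norm.
  have E w : `| `| `|v m n| *: c + w| - `|r *: c + w| | <= `|c| * `| `|v m n| - r|.
    rewrite (le_trans (ler_dist_dist _ _))// opprD addrACA subrr addr0 -scalerBl.
    by rewrite normrZ mulrC.
  have := E (v m n); have := E (- v m n).
  rewrite !ler_norml => /andP[? ?] /andP[? ?]; lra.
rewrite ulim2Z// ulim2_norm// ulim2D//; last by exists `|- r|.
by rewrite ulim2_fst ulim_cst// subrr normr0 mulr0.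
Qed.

Lemma tilted_norm_lip (c c' x : X) :
  `|tilted_norm c x - tilted_norm c' x| <= 2 * `|x| * `|c - c'|.
Proof.
have E w : `| `| `|x| *: c + w| - `| `|x| *: c' + w| | <= `|x| * `|c - c'|.
  rewrite (le_trans (ler_dist_dist _ _))// opprD addrACA subrr addr0 -scalerBr.
  by rewrite normrZ normr_id.
have := E x; have := E (- x); rewrite /tilted_norm.
by rewrite !ler_norml => /andP[? ?] /andP[? ?]; lra.
Qed.

Lemma ulim2_tilted_norm_lip v c c' M : (forall m n, `|v m n| <= M) ->
  `|ulim2 U (fun m n => tilted_norm c (v m n)) -
    ulim2 U (fun m n => tilted_norm c' (v m n))| <= 2 * M * `|c - c'|.
Proof.
move=> vM; have bv : bnd2 (fun m n => `|v m n| : R).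
  by exists M => m n; rewrite normr_id.
apply: (@le_trans _ _ (ulim2 U (fun _ _ => 2 * M * `|c - c'|))).
  apply: ulim2_dist_le => //.
  - exact: seminorm_bnd2 (tilted_norm_seminorm c) bv.
  - exact: seminorm_bnd2 (tilted_norm_seminorm c') bv.
  - by exists `|2 * M * `|c - c'| |.
  - by move=> m n; rewrite (le_trans (tilted_norm_lip _ _ _))// ler_wpM2r// ler_wpM2l.
by rewrite ulim2_fst// ulim_cst.
Qed.

Variables (N : X -> R) (c : nat -> X).
Hypothesis c_dense : dense_seq c.
Hypothesis N_split : forall k, exists (a : R) (r : X -> R),
  [/\ 0 < a, dominated_seminorm r & forall x, N x = a * tilted_norm (c k) x + r x].

(* Any inequality between iterated limits that holds for every seminorm must be
   an equality for every [tilted_norm] as soon as it is one for [N]. *)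
Lemma tilted_norm_extremal v w :
  bnd2 (fun m n => `|v m n| : R) -> bnd2 (fun m n => `|w m n| : R) ->
  (forall p, dominated_seminorm p ->
    ulim2 U (fun m n => p (v m n)) <= ulim2 U (fun m n => p (w m n))) ->
  ulim2 U (fun m n => N (w m n)) <= ulim2 U (fun m n => N (v m n)) ->
  forall d, ulim2 U (fun m n => tilted_norm d (v m n)) =
            ulim2 U (fun m n => tilted_norm d (w m n)).
Proof.
move=> bv bw le_vw Nwv d.
have E k : ulim2 U (fun m n => tilted_norm (c k) (v m n)) =
           ulim2 U (fun m n => tilted_norm (c k) (w m n)).
  have [a [r [a0 rs Nr]]] := N_split k; have ts := tilted_norm_seminorm (c k).
  apply/le_anti; rewrite le_vw//= -(ler_pM2l a0).
  have NE u : bnd2 (fun m n => `|u m n| : R) -> ulim2 U (fun m n => N (u m n)) =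
      a * ulim2 U (fun m n => tilted_norm (c k) (u m n)) +
      ulim2 U (fun m n => r (u m n)).
    move=> bu; have bt := seminorm_bnd2 ts bu; have br := seminorm_bnd2 rs bu.
    rewrite -ulim2Z// -ulim2D//; last exact: bnd2Z.
    by congr (ulim2 U); apply/funext => m; apply/funext => n.
  by move: Nwv; rewrite !NE//; have := le_vw _ rs; lra.
have [M vM] := bv; have [M' wM'] := bw.
have vM1 m n : `|v m n| <= `|M| + `|M'|.
  by rewrite -[leLHS]normr_id (le_trans (vM m n))// (le_trans (ler_norm _))// lerDl.
have wM1 m n : `|w m n| <= `|M| + `|M'|.
  by rewrite -[leLHS]normr_id (le_trans (wM' m n))// (le_trans (ler_norm _))// lerDr.
set K := `|M| + `|M'| in vM1 wM1; have K0 : 0 <= K by rewrite addr_ge0.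
apply/eqP; rewrite -subr_eq0 -normr_le0; apply/ler_addgt0Pl => e e0; rewrite addr0.
have e'0 : 0 < e / (4 * K + 1) by rewrite divr_gt0// ltr_wpDl// mulr_ge0.
have [k dk] := c_dense d e'0.
have L1 := ulim2_tilted_norm_lip d (c k) vM1.
have L2 := ulim2_tilted_norm_lip d (c k) wM1.
have dk' : (4 * K + 1) * `|d - c k| < e.
  by rewrite mulrC -ltr_pdivlMr// ltr_wpDl// mulr_ge0.
move: L1 L2; rewrite E !ler_norml; have := normr_ge0 (d - c k).
by move=> ? /andP[? ?] /andP[? ?]; nra.
Qed.

Variable x : nat -> X.
Hypothesis x_bnd : bnd (fun n => `|x n| : R).

Lemma bnd2_sumseq : bnd2 (fun m n => `|x m + x n| : R).
Proof.
have [M xM] := x_bnd; exists (M + M) => m n; rewrite normr_id.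
rewrite (le_trans (ler_normD _ _))// -[`|x m|]normr_id -[`|x n|]normr_id.
by rewrite lerD.
Qed.

Lemma bnd2_fst : bnd2 (fun m (_ : nat) => `|x m| : R).
Proof. by have [M xM] := x_bnd; exists M => m n. Qed.

Lemma bnd_seminorm p : dominated_seminorm p -> bnd (fun n => p (x n) : R).
Proof.
by move=> ps; have [M h] := seminorm_bnd2 ps bnd2_fst; exists M => n; exact: (h n 0%N).
Qed.

Lemma ulim2_sum_le p : dominated_seminorm p ->
  ulim2 U (fun m n => p (x m + x n)) <= ulim2 U (fun m _ => p (2 *: x m)).
Proof.
move=> ps; have [pD pZ _] := ps; have bp := bnd_seminorm ps.
have bp1 : bnd2 (fun m (_ : nat) => p (x m)).
  by have [M h] := bp; exists M => m n.
have bp2 : bnd2 (fun (_ : nat) m => p (x m)).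
  by have [M h] := bp; exists M => m n.
have -> : (fun m (_ : nat) => p (2 *: x m)) = (fun m _ => 2 * p (x m)).
  by apply/funext => m; apply/funext => _; rewrite seminormZ.
rewrite ulim2Z// ulim2_fst//.
apply: (@le_trans _ _ (ulim2 U (fun m n => p (x m) + p (x n)))).
  apply: ulim2_le => //; [exact: seminorm_bnd2 bnd2_sumseq|exact: bnd2D].
by rewrite ulim2D// ulim2_fst// ulim2_snd// mulr_natl.
Qed.

Lemma tilted_norm0 (z : X) : tilted_norm 0 z = 2 * `|z|.
Proof. by rewrite /tilted_norm scaler0 add0r sub0r normrN mulr2n mulrDl mul1r. Qed.

Lemma ulim2_norm_eq v w :
  bnd2 (fun m n => `|v m n| : R) -> bnd2 (fun m n => `|w m n| : R) ->
  (forall d, ulim2 U (fun m n => tilted_norm d (v m n)) =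
             ulim2 U (fun m n => tilted_norm d (w m n))) ->
  ulim2 U (fun m n => `|v m n|) = ulim2 U (fun m n => `|w m n|).
Proof.
move=> bv bw /(_ 0).
under [X in ulim2 U X]eq_fun do under eq_fun do rewrite tilted_norm0.
under [X in _ = ulim2 U X]eq_fun do under eq_fun do rewrite tilted_norm0.
by rewrite !ulim2Z//; lra.
Qed.

Lemma bnd_normD (u : nat -> X) (y : X) : bnd (fun n => `|u n| : R) ->
  bnd (fun n => `|y + u n| : R).
Proof.
move=> [M uM]; exists (`|y| + M) => n; rewrite normr_id.
by rewrite (le_trans (ler_normD _ _))// lerD2l (le_trans _ (uM n))// normr_id.
Qed.

(** With the tilt [r^-1 *: y], the extremal equality gives only the sum of the desired identity and
    of the one for [- x]. Each of the two is already an inequality ([half]) in the same direction,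
    so both are equalities. *)
Lemma ulim2_double_norm (y : X) : 0 < ulim U (fun n => `|x n|) ->
  2 * ulim U (fun n => N (x n)) <= ulim2 U (fun m n => N (x m + x n)) ->
  dominated_seminorm N ->
  ulim2 U (fun m n => `|2 *: y + (x m + x n)|) = 2 * ulim U (fun n => `|y + x n|).
Proof.
set r := ulim U _ => r0 NN Ns.
have b2 : bnd2 (fun m (_ : nat) => `|2 *: x m| : R).
  have [M h] := x_bnd; exists (2 * M) => m n.
  by rewrite normr_id normrZ ger0_norm// ler_wpM2l// -[leLHS]normr_id.
have bs := bnd2_sumseq.
have ext d : ulim2 U (fun m n => tilted_norm d (x m + x n)) =
             ulim2 U (fun m _ => tilted_norm d (2 *: x m)).
  apply: (tilted_norm_extremal bs b2 ulim2_sum_le); rewrite ulim2_fst//.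
  have -> : (fun m => N (2 *: x m)) = (fun m => 2 * N (x m)).
    by apply/funext => m; rewrite seminormZ.
  by rewrite ulimZ//; exact: bnd_seminorm.
have r2 : ulim2 U (fun m (_ : nat) => `|2 *: x m|) = 2 * r.
  rewrite ulim2_fst// -ulimZ//; congr ulim; apply/funext => n.
  by rewrite normrZ ger0_norm.
have := ext (r^-1 *: y); rewrite ulim2_tilted_norm//= ulim2_tilted_norm//=.
rewrite (ulim2_norm_eq bs b2 ext) r2.
rewrite scalerA -mulrA divff ?gt_eqF// mulr1.
have half (u : nat -> X) : bnd (fun n => `|u n| : R) ->
    ulim2 U (fun m n => `|2 *: y + (u m + u n)|) <=
    2 * ulim U (fun n => `|y + u n|).
  move=> bu; have by1 := bnd_normD y bu; have [M yM] := by1.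
  have b1 : bnd2 (fun m (_ : nat) => `|y + u m| : R) by exists M => m n; exact: yM.
  have b3 : bnd2 (fun (_ : nat) m => `|y + u m| : R) by exists M => m n; exact: yM.
  have -> : 2 * ulim U (fun n => `|y + u n|) =
      ulim2 U (fun m _ => `|y + u m|) + ulim2 U (fun _ n => `|y + u n|).
    by rewrite ulim2_fst// ulim2_snd//; ring.
  rewrite -ulim2D//.
  have le2 m n : `|2 *: y + (u m + u n)| <= `|y + u m| + `|y + u n|.
    by rewrite scaler_nat mulr2n addrACA ler_normD.
  apply: ulim2_le => //; last exact: bnd2D.
  exists (M + M) => m n; rewrite normr_id (le_trans (le2 m n))//.
  by rewrite -[`|y + u m|]normr_id -[`|y + u n|]normr_id lerD.
have full (u : nat -> X) : bnd (fun n => `|u n| : R) ->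
    ulim2 U (fun m _ => `|2 *: y + 2 *: u m|) = 2 * ulim U (fun n => `|y + u n|).
  move=> bu; rewrite ulim2_fst// -ulimZ; last exact: bnd_normD.
  by congr ulim; apply/funext => n; rewrite -scalerDr normrZ ger0_norm.
have bN : bnd (fun n => `|- x n| : R).
  by have [M h] := x_bnd; exists M => n; rewrite normrN.
have hN : ulim2 U (fun m n => `|2 *: y - (x m + x n)|) <=
    2 * ulim U (fun n => `|y - x n|).
  have := half _ bN; rewrite (@ulim2_congr _ _ _ (fun m n =>
    `|2 *: y - (x m + x n)|))// => m n.
  by rewrite opprD.
have fN : ulim2 U (fun m _ => `|2 *: y - 2 *: x m|) =
    2 * ulim U (fun n => `|y - x n|).
  by rewrite -(full _ bN); apply: ulim2_congr => m n; rewrite scalerN.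
have := half _ x_bnd; have := full _ x_bnd.
by lra.
Qed.

(** The two signs are separated as in [ulim2_double_norm], but the basic inequality is now weak
    lower semicontinuity, which makes adding [x n] nondecreasing in the limit for every dominated
    seminorm. *)
Lemma ulim2_shift_norm (y : X) : 0 < ulim U (fun n => `|x n|) ->
  ulim2 U (fun m n => N (x m + x n)) <= ulim U (fun n => N (x n)) ->
  (forall p z, dominated_seminorm p -> p z <= ulim U (fun n => p (z + x n))) ->
  ulim2 U (fun m n => `|y + (x m + x n)|) = ulim U (fun n => `|y + x n|).
Proof.
set r := ulim U _ => r0 NN wlsc; have bs := bnd2_sumseq; have b1 := bnd2_fst.
have low p : dominated_seminorm p ->
    ulim2 U (fun m _ => p (x m)) <= ulim2 U (fun m n => p (x m + x n)).
  move=> ps; apply: (ulim_le UU).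
  - apply: (bnd2_ulim UU (w := fun m _ => p (x m))).
    exact: seminorm_bnd2 ps b1.
  - apply: (bnd2_ulim UU (w := fun m n => p (x m + x n))).
    exact: seminorm_bnd2 ps bs.
  - by move=> m; rewrite ulim_cst//; exact: wlsc.
have ext d : ulim2 U (fun m _ => tilted_norm d (x m)) =
             ulim2 U (fun m n => tilted_norm d (x m + x n)).
  by apply: (tilted_norm_extremal b1 bs low); rewrite ulim2_fst.
have := ext (r^-1 *: y); rewrite ulim2_tilted_norm//= ulim2_tilted_norm//=.
rewrite -(ulim2_norm_eq b1 bs ext) !(ulim2_fst UU) -/r scalerA divff ?gt_eqF// scale1r.
have half (z : X) (u : nat -> X) : bnd (fun n => `|u n| : R) ->
    (forall z, `|z| <= ulim U (fun n => `|z + u n|)) ->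
    ulim U (fun m => `|z + u m|) <= ulim2 U (fun m n => `|z + (u m + u n)|).
  move=> bu ul; have bz := bnd_normD z bu; have [M uM] := bu.
  apply: (ulim_le UU) => //.
    apply: (bnd2_ulim UU (w := fun m n => `|z + (u m + u n)|)).
    apply: bnd2_normD; exists (M + M) => m n; rewrite normr_id.
    rewrite (le_trans (ler_normD _ _))//.
    by rewrite -[`|u m|]normr_id -[`|u n|]normr_id lerD.
  move=> m; rewrite (_ : (fun n => _) = fun n => `|z + u m + u n|)//.
  by apply/funext => n; rewrite addrA.
have bN : bnd (fun n => `|- x n| : R).
  by have [M h] := x_bnd; exists M => n; rewrite normrN.
have wN z : `|z| <= ulim U (fun n => `|z - x n|).
  rewrite (_ : (fun n => _) = fun n => `|- z + x n|); last first.
    by apply/funext => n; rewrite -normrN opprB addrC.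
  by rewrite -normrN; exact: wlsc (norm_seminorm X).
have := half y _ x_bnd (fun z => wlsc _ z (norm_seminorm X)).
have := half y _ bN wN.
rewrite (@ulim2_congr _ _ _ (fun m n => `|y - (x m + x n)|)); last first.
  by move=> m n; rewrite opprD.
move=> h1 h2 h3.
by apply/le_anti/andP; split => //; lra.
Qed.

End IteratedNorms.

(** * Types of sequences *)

Section Selection.
Variables (R : realType) (U : set_system nat).
Hypothesis UU : UltraFilter U.

(** Dependent choice in which the state records all that later terms must respect: compact sets of
    combinations, partial sums, or the indices already taken. *)
Lemma iterated_selection (S : Type) (step : S -> nat -> S) (good : S -> Prop) s0 :
  good s0 -> (forall s, good s -> exists m, good (step s m)) ->
  exists (phi : nat -> nat) (st : nat -> S), [/\ st 0%N = s0,
    forall k, good (st k) & forall k, st k.+1 = step (st k) (phi k)].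
Proof.
move=> g0 gS; pose pick s := xget 0%N [set m | good (step s m)].
pose st := fix st k := if k is l.+1 then step (st l) (pick (st l)) else s0.
exists (fun k => pick (st k)), st; split => //.
by elim=> //= k /gS[m gm]; rewrite /pick; case: xgetP => // /(_ m).
Qed.

(** The modulus [D] does not depend on [m], so a [U]-large set of indices good at one point serves a
    neighbourhood of it; finitely many neighbourhoods cover [K]. This lets a single index work for
    all earlier combinations. *)
Lemma compact_uniform_gt (T : topologicalType) (K : set T) (F : nat -> T -> R)
    (D : T -> T -> R) (e : R) :
  compact K -> (forall x, K x -> bnd (F ^~ x)) ->
  (forall m x y, F m x - D x y <= F m y) ->
  (forall x, D x y @[y --> x] --> (0 : R)) ->
  (forall x, K x -> e < ulim U (F ^~ x)) ->
  \forall m \near U, forall x, K x -> e < F m x.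
Proof.
move=> /compact_near_coveringP cK bF FD D0 KF.
have := cK nat U (fun m x => e < F m x) _; apply=> // x Kx.
have [d0 d1] : e < (e + ulim U (F ^~ x)) / 2 /\
  (e + ulim U (F ^~ x)) / 2 < ulim U (F ^~ x) by split; have := KF x Kx; lra.
set d := (e + _) / 2 in d0 d1.
have UF := ulim_gt_near UU (bF x Kx) d1.
have Dx : \forall y \near x, D x y < d - e.
  by apply: cvgr_lt (D0 x) _ _; rewrite subr_gt0.
near=> y m; have h1 : D x y < d - e by near: y.
have h2 : d < F m x by near: m.
by have := FD m x y; rewrite /=; lra.
Unshelve. all: by end_near. Qed.

End Selection.

Section TypeOfSequence.
Variables (R : realType) (X : normedModType R) (U : set_system nat).
Hypothesis UU : UltraFilter U.
Variables (x : nat -> X) (M : R).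
Hypothesis x_le : forall n, `|x n| <= M.

Let M_ge0 : 0 <= M. Proof. exact: le_trans (x_le 0%N). Qed.

(* The value at [y + t e] of the norm of the one-dimensional extension of [X]
   obtained by adjoining the ultralimit [e] of [x]. *)
Definition type_norm (y : X) (t : R) : R := ulim U (fun n => `|y + t *: x n|).

Lemma type_norm_bnd y t : bnd (fun n => `|y + t *: x n| : R).
Proof.
exists (`|y| + `|t| * M) => n; rewrite normr_id (le_trans (ler_normD _ _))//.
by rewrite normrZ lerD2l ler_wpM2l.
Qed.

Lemma type_norm0 y : type_norm y 0 = `|y|.
Proof.
rewrite -[RHS](ulim_cst UU); congr ulim.
by apply/funext => n; rewrite scale0r addr0.
Qed.

Lemma type_norm_lip y t y' t' :
  type_norm y t - (`|y - y'| + `|t - t'| * M) <= type_norm y' t'.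
Proof.
have bc (a : R) : bnd (fun _ : nat => a) by exact: bnd_cst.
rewrite -[X in _ - X](ulim_cst UU) lerBlDr -ulimD//; last exact: type_norm_bnd.
apply: (ulim_le UU); [exact: type_norm_bnd|apply: bndD => //|move=> n].
  exact: type_norm_bnd.
rewrite -[y + _](subrK (y' + t' *: x n)) (le_trans (ler_normD _ _))// addrC lerD2l.
rewrite opprD addrACA -scalerBl (le_trans (ler_normD _ _))// lerD2l normrZ.
by rewrite ler_wpM2l.
Qed.

Lemma type_normZ (a : R) y t : 0 <= a ->
  type_norm (a *: y) (a * t) = a * type_norm y t.
Proof.
move=> a0; rewrite /type_norm -ulimZ//; last exact: type_norm_bnd.
congr ulim; apply/funext => n.
by rewrite -scalerA -scalerDr normrZ ger0_norm.
Qed.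

Lemma type_norm_ge0 y t : 0 <= type_norm y t.
Proof. by apply: (ulim_ge_cst UU); [exact: type_norm_bnd|]. Qed.

Lemma bnd_type_norm (y : nat -> X) t : bnd (fun n => `|y n| : R) ->
  bnd (fun n => type_norm (y n) t).
Proof.
move=> [K yK]; exists (K + `|t| * M) => m; rewrite ger0_norm ?type_norm_ge0//.
apply: (ulim_le_cst UU); first exact: type_norm_bnd.
move=> n; rewrite (le_trans (ler_normD _ _))// lerD//.
  by rewrite -[leLHS]normr_id.
by rewrite normrZ ler_wpM2l.
Qed.

(* As a function of [a], the iterated limit is convex on [0, b] and takes the
   same value at [0], [b / 2] and [b], so it is nowhere smaller. *)
Lemma type_norm_le_shift (y : X) (a b : R) :
  (forall z, ulim2 U (fun m n => `|2 *: z + (x m + x n)|) =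
             2 * ulim U (fun n => `|z + x n|)) ->
  0 <= a <= b ->
  type_norm y b <= ulim U (fun m => type_norm (y + a *: x m) (b - a)).
Proof.
move=> H /andP[a0 ab].
have [b0|b0] := leP b 0.
  have -> : a = 0 by lra.
  have -> : b = 0 by lra.
  rewrite subrr (_ : (fun m => _) = fun=> type_norm y 0) ?ulim_cst//.
  by apply/funext => m; rewrite scale0r addr0.
pose w (a : R) m n : R := `|y + a *: x m + (b - a) *: x n|.
have bw c : bnd2 (w c).
  exists (`|y| + `|c| * M + `|b - c| * M) => m n; rewrite normr_id /w.
  rewrite (le_trans (ler_normD _ _))// normrZ lerD// ?ler_wpM2l//.
  by rewrite (le_trans (ler_normD _ _))// lerD2l normrZ ler_wpM2l.
pose g c := ulim2 U (w c); change (type_norm y b <= g a).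
have g0 : g 0 = type_norm y b.
  rewrite /g /type_norm -(ulim2_snd UU); apply: ulim2_congr => m n.
  by rewrite /w scale0r addr0 subr0.
have gb : g b = type_norm y b.
  rewrite /g /type_norm -(ulim2_fst UU); apply: ulim2_congr => m n.
  by rewrite /w subrr scale0r addr0.
have gm : g (b / 2) = type_norm y b.
  have b20 : 0 <= b / 2 by rewrite divr_ge0// ltW.
  have := H (b^-1 *: y); rewrite -/(type_norm _ _) => Hb.
  have -> : type_norm y b = b / 2 * (2 * ulim U (fun n => `|b^-1 *: y + x n|)).
    rewrite mulrA mulfVK//; transitivity (b * type_norm (b^-1 *: y) 1).
      by rewrite -type_normZ ?ltW// scalerA divff ?gt_eqF// scale1r mulr1.
    by congr (_ * ulim U _); apply/funext => n; rewrite scale1r.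
  rewrite -Hb -ulim2Z//; last first.
    by apply: (bnd2_normD (v := fun m n => x m + x n)); exists (M + M) => m n;
      rewrite normr_id (le_trans (ler_normD _ _))// lerD.
  apply: ulim2_congr => m n; rewrite /w -[X in X * `|_|](ger0_norm b20) -normrZ.
  congr (`| _ |); have -> : b - b / 2 = b / 2 by field.
  rewrite scalerDr !scalerA scalerDr addrA; congr (_ + _ + _).
  by rewrite mulfVK// divff ?gt_eqF// scale1r.
have gconv l c d : 0 <= l <= 1 -> g (l * c + (1 - l) * d) <= l * g c + (1 - l) * g d.
  move=> /andP[l0 l1]; rewrite /g -!(ulim2Z UU)// -(ulim2D UU); [|exact: bnd2Z..].
  apply: ulim2_le => //; first by apply: bnd2D; exact: bnd2Z.
  move=> m n; have l1' : 0 <= 1 - l by rewrite subr_ge0.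
  rewrite /w -[X in _ <= X * _ + _]ger0_norm// -[X in _ <= _ + X * _]ger0_norm//.
  rewrite -!normrZ (le_trans _ (ler_normD _ _))//.
  rewrite le_eqVlt; apply/orP; left; apply/eqP; congr (`| _ |).
  rewrite !scalerDr !scalerA addrACA -scalerDl [in RHS]addrACA -2!scalerDl.
  have -> : l + (1 - l) = 1 by ring.
  by rewrite scale1r; congr (_ + _ *: _); ring.
have [ab2|ab2] := leP a (b / 2).
  have ba : 0 < b - a by lra.
  pose l := b / 2 / (b - a).
  have l0 : 0 < l by rewrite !divr_gt0.
  have l1 : l <= 1 by rewrite ler_pdivrMr//; lra.
  have := gconv l a b; rewrite (ltW l0) l1 => /(_ isT).
  have -> : l * a + (1 - l) * b = b / 2 by rewrite /l; field; rewrite gt_eqF.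
  rewrite gm gb => h; rewrite -(ler_pM2l l0); lra.
have a1 : 0 < a by lra.
pose l := b / 2 / a.
have l0 : 0 < l by rewrite !divr_gt0.
have l1 : l <= 1 by rewrite ler_pdivrMr//; lra.
have := gconv l a 0; rewrite (ltW l0) l1 => /(_ isT).
have -> : l * a + (1 - l) * 0 = b / 2 by rewrite /l; field; rewrite gt_eqF.
rewrite gm g0 => h; rewrite -(ler_pM2l l0); lra.
Qed.

End TypeOfSequence.

Section CompactImages.
Variables (R : realType) (X : normedModType R).

(** Minkowski sum of [A] with the segment from 0 to [u]. Iterating it gives zonotopes, which grow by
    one generator at a time without a joint constraint on the coefficients. *)
Definition segment_sums (A : set X) (u : X) : set X :=
  [set z | exists v (s : R), [/\ A v, 0 <= s <= 1 & z = v + s *: u]].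

Lemma segment_sums_compact A u : compact A -> compact (segment_sums A u).
Proof.
move=> cA; have cI := compact_setX cA (@segment_compact R 0 1).
have := continuous_compact (f := fun z : X * R => z.1 + z.2 *: u) _ cI.
have -> : [set z.1 + z.2 *: u | z in A `*` `[0, 1]%classic] = segment_sums A u.
  apply/seteqP; split.
    by move=> _ [[v s] /= [Av +] <-]; rewrite in_itv/= => s01; exists v, s.
  by move=> _ [v [s [Av s01 ->]]]; exists (v, s) => //; split => //=; rewrite in_itv.
apply; apply: continuous_subspaceT => z.
by apply: cvgD; [exact: cvg_fst|apply: cvgZl; exact: cvg_snd].
Qed.

Lemma segment_sums_convex A u : is_convex A -> is_convex (segment_sums A u).
Proof.
move=> cA a _ _ a01 [v [s [Av s01 ->]]] [w [t [Aw t01 ->]]].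
exists (a *: v + (1 - a) *: w), (a * s + (1 - a) * t); split.
- exact: cA.
- by move: a01 s01 t01 => /andP[? ?] /andP[? ?] /andP[? ?]; apply/andP; nra.
- by rewrite !scalerDr !scalerA addrACA -scalerDl.
Qed.

Lemma segment_sums_sub A u : A `<=` segment_sums A u.
Proof. by move=> v Av; exists v, 0; rewrite scale0r addr0 lexx ler01. Qed.

(* [(y, b)] stands for [y] plus [b] times the adjoined ultralimit: a fraction [s]
   of that weight [b] is moved onto [u]. *)
Definition mass_transfers (A : set (X * R)) (u : X) : set (X * R) :=
  [set z | exists y b s, [/\ A (y, b), 0 <= s <= 1 &
    z = (y + (s * b) *: u, b - s * b)]].

Lemma mass_transfers_compact A u : compact A -> compact (mass_transfers A u).
Proof.
move=> cA; have cI := compact_setX cA (@segment_compact R 0 1).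
have := continuous_compact (f := fun z : (X * R) * R =>
  (z.1.1 + (z.2 * z.1.2) *: u, z.1.2 - z.2 * z.1.2)) _ cI.
set B := [set _ | _ in _]; have -> : B = mass_transfers A u.
  apply/seteqP; split.
    by move=> _ [[[y b] s] /= [Av +] <-]; rewrite in_itv/= => s01; exists y, b, s.
  move=> _ [y [b [s [Av s01 ->]]]].
  by exists (y, b, s) => //; split => //=; rewrite in_itv.
apply; apply: continuous_subspaceT => z.
have c1 : z'.1.1 @[z' --> z] --> z.1.1.
  by apply: (cvg_comp _ _ cvg_fst); exact: cvg_fst.
have c2 : z'.1.2 @[z' --> z] --> z.1.2.
  by apply: (cvg_comp _ _ cvg_fst); exact: cvg_snd.
have c3 : z'.2 * z'.1.2 @[z' --> z] --> z.2 * z.1.2.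
  by apply: cvgM => //; exact: cvg_snd.
exact: (cvg_pair (cvgD c1 (cvgZl c3)) (cvgB c2 c3)).
Qed.

End CompactImages.

Section ReflexiveApproximation.
Variables (R : realType) (X : normedModType R) (U : set_system nat).
Hypothesis (UU : UltraFilter U) (cofU : \oo `<=` U).
Variables (Y : submodClosed X) (x : nat -> X).
Hypotheses (reflY : reflexive_space (sublmod Y)) (xY : forall n, x n \in Y).
Hypothesis x_bnd : bnd (fun n => `|x n| : R).
Hypothesis x_double : forall z, ulim2 U (fun m n => `|2 *: z + (x m + x n)|) =
  2 * ulim U (fun n => `|z + x n|).

Let xM : exists M, forall n, `|x n| <= M.
Proof. by have [M h] := x_bnd; exists M => n; rewrite -[leLHS]normr_id. Qed.

(** By [type_norm_le_shift], moving weight from the adjoined ultralimit onto [x m] does not decrease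
    the norm in the limit over [m]; compactness of [W] and of the range of fractions makes this
    uniform. *)
Lemma mass_transfer_step (W : set (X * R)) (e : R) : compact W ->
  (forall y b, W (y, b) -> 0 <= b /\ e < type_norm U x y b) ->
  \forall m \near U, forall y b, mass_transfers W (x m) (y, b) ->
    0 <= b /\ e < type_norm U x y b.
Proof.
move=> cW We; have [M xm] := xM; have M0 : 0 <= M := le_trans (normr_ge0 _) (xm 0%N).
pose F m (z : (X * R) * R) :=
  type_norm U x (z.1.1 + (z.2 * z.1.2) *: x m) (z.1.2 - z.2 * z.1.2).
pose D (z z' : (X * R) * R) : R := `|z.1.1 - z'.1.1| +
  `|z.2 * z.1.2 - z'.2 * z'.1.2| * M +
  `|(z.1.2 - z.2 * z.1.2) - (z'.1.2 - z'.2 * z'.1.2)| * M.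
suff : \forall m \near U, forall z, (W `*` `[0, 1]%classic) z -> e < F m z.
  apply: filterS => m h _ _ [y [b [s [Wyb s01 [-> ->]]]]].
  have [b0 _] := We _ _ Wyb; have /andP[s0 s1] := s01; split.
    by rewrite subr_ge0 ler_piMl.
  by apply: (h (y, b, s)); split => //=; rewrite in_itv.
apply: (@compact_uniform_gt R U UU _ _ F D e).
- exact: compact_setX cW (@segment_compact R 0 1).
- move=> [[y b] s] _; apply: (bnd_type_norm UU xm).
  exact: type_norm_bnd xm _ _.
- move=> m z z'; apply: le_trans (type_norm_lip UU xm
    (z.1.1 + (z.2 * z.1.2) *: x m) (z.1.2 - z.2 * z.1.2) _ _).
  rewrite lerB// /D lerD2r opprD addrACA -scalerBl (le_trans (ler_normD _ _))//.
  by rewrite lerD2l normrZ ler_wpM2l.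
- move=> z.
  have c1 : z'.1.1 @[z' --> z] --> z.1.1.
    by apply: (cvg_comp _ _ cvg_fst); exact: cvg_fst.
  have c2 : z'.1.2 @[z' --> z] --> z.1.2.
    by apply: (cvg_comp _ _ cvg_fst); exact: cvg_snd.
  have c3 : z'.2 * z'.1.2 @[z' --> z] --> z.2 * z.1.2.
    by apply: cvgM => //; exact: cvg_snd.
  have -> : (0 : R) = D z z by rewrite /D !subrr !normr0 !mul0r !addr0.
  apply: cvgD; first apply: cvgD.
  + by apply: cvg_norm; apply: cvgB => //; exact: cvg_cst.
  + apply: cvgMl; apply: cvg_norm; apply: cvgB => //; exact: cvg_cst.
  + apply: cvgMl; apply: cvg_norm; apply: cvgB; first exact: cvg_cst.
    exact: cvgB.
- move=> [[y b] s] /= [/We[b0 eb]]; rewrite in_itv/= => /andP[s0 s1].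
  rewrite (lt_le_trans eb)// (type_norm_le_shift UU xm)// mulr_ge0//=.
  by rewrite ler_piMl.
Qed.

(* [V k] is the set of sums of the [u i], [i < k], with coefficients in [0, 1];
   it stands in for their convex hull. *)
Lemma type_mass_transfer (e : R) :
  (forall c, e < type_norm U x (- c) 1) ->
  exists (u : nat -> X) (V : nat -> set X) (W : nat -> set (X * R)),
    [/\ forall k, u k \in Y, bnd (fun k => `|u k| : R) & V 0%N = [set 0]] /\
    [/\ forall k, V k.+1 = segment_sums (V k) (u k),
      forall k v, V k v -> W k (- v, 1),
      forall k, mass_transfers (W k) (u k) `<=` W k.+1 &
      forall k y, W k (y, 0) -> e < `|y|].
Proof.
move=> xe; have [M xm] := xM.
pose V' (S : set X * set (X * R)) m := segment_sums S.1 (x m).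
(* Each new [v] enters the second component as [- v] with the whole weight 1 on the ultralimit,
   where [xe] bounds it. Transfers spend this weight on later terms; at weight 0, [type_norm] is the
   norm of a difference of hull points. *)
pose step (S : set X * set (X * R)) m :=
  (V' S m, mass_transfers S.2 (x m) `|` [set (- v, 1) | v in V' S m]).
pose good (S : set X * set (X * R)) := [/\ compact S.1, compact S.2 &
  forall y b, S.2 (y, b) -> 0 <= b /\ e < type_norm U x y b].
have [||phi [st [st0 stg stS]]] :=
    @iterated_selection _ step good ([set 0], [set (- 0, 1)]).
- split; [exact: compact_set1|exact: compact_set1|].
  by move=> y b [-> ->]; split; last exact: xe.
- move=> [V W] [cV cW We].
  have [m mP] := filter_ex (mass_transfer_step cW We).
  have cV' := segment_sums_compact (u := x m) cV.
  exists m; split => //.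
    apply: compactU; first exact: mass_transfers_compact.
    apply: continuous_compact cV'; apply: continuous_subspaceT => v.
    have c1 : - v' @[v' --> v] --> - v by apply: cvgN; exact: cvg_id.
    have c2 : (1 : R) @[v' --> v] --> (1 : R) by exact: cvg_cst.
    exact: (cvg_pair c1 c2).
  by move=> y b [/mP//|[v _ [<- <-]]]; split => //; exact: xe.
exists (x \o phi), (fun k => (st k).1), (fun k => (st k).2); split; split.
- by move=> k; exact: xY.
- by exists M => k; rewrite normr_id; exact: xm.
- by rewrite st0.
- by move=> k; rewrite stS.
- move=> [|k] v; first by rewrite st0 => ->.
  by rewrite stS => Vv; right; exists v.
- by move=> k z; rewrite stS; left.
- move=> k y Wy; have [_ _ /(_ _ _ Wy)[_]] := stg k.
  by rewrite type_norm0.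
Qed.

(* [(w, b)] belongs to it when [w] is a combination of [u k], ..., [u (k + j - 1)]
   with nonnegative coefficients of sum [1 - b]. *)
Fixpoint tail_hull (u : nat -> X) k j : set (X * R) :=
  if j is i.+1 then [set z | exists y b t, [/\ tail_hull u k i (y, b),
    0 <= t <= b & z = (y + t *: u (k + i)%N, b - t)]]
  else [set (0, 1)].

Lemma tail_hull_convex u k j (a : R) y b z c : 0 <= a <= 1 ->
  tail_hull u k j (y, b) -> tail_hull u k j (z, c) ->
  tail_hull u k j (a *: y + (1 - a) *: z, a * b + (1 - a) * c).
Proof.
move=> a01; elim: j y b z c => [|j IH] y b z c /=.
  move=> [-> ->] [-> ->]; rewrite !scaler0 addr0; congr (_, _); ring.
move=> [y' [b' [t [h tb [-> ->]]]]] [z' [c' [s [h' sc [-> ->]]]]].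
exists (a *: y' + (1 - a) *: z'), (a * b' + (1 - a) * c'), (a * t + (1 - a) * s).
split; first exact: IH.
  by move: a01 tb sc => /andP[? ?] /andP[? ?] /andP[? ?]; apply/andP; nra.
congr (_, _); last by ring.
by rewrite !scalerDr !scalerA addrACA -scalerDl.
Qed.

Lemma tail_hull_ge0 u k j y b : tail_hull u k j (y, b) -> 0 <= b.
Proof.
case: j => [[_ ->]//|j] /= [y' [b' [t [_ /andP[_ tb] [_ ->]]]]].
by rewrite subr_ge0.
Qed.

Lemma tail_hull_mono u k i j y b : (i <= j)%N -> tail_hull u k i (y, b) ->
  tail_hull u k j (y, b).
Proof.
elim: j => [|j IH]; first by rewrite leqn0 => /eqP ->.
rewrite leq_eqVlt ltnS => /predU1P[->//|/IH{}IH h].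
exists y, b, 0; split; [exact: IH|by rewrite lexx (tail_hull_ge0 h)|].
by rewrite scale0r addr0 subr0.
Qed.

(** Otherwise the selected [u] has initial sets [V k] and tail hulls that stay more than [e] apart,
    against [james_close_convex]. *)
Lemma reflexive_type_approx (e : R) : 0 < e ->
  exists c, type_norm U x (- c) 1 <= e.
Proof.
move=> e0; apply: contrapT => xe.
have [|u [V [W [[uY ub V0] [VS WV WS We]]]]] := @type_mass_transfer e.
  by move=> c; rewrite ltNge; apply/negP => ce; apply: xe; exists c.
have Vu k : V k 0.
  by elim: k => [|k IH]; rewrite ?V0// VS; exact: segment_sums_sub.
have hullW k j v y b : V k v -> tail_hull u k j (y, b) -> W (k + j)%N (y - v, b).
  move=> Vv; elim: j y b => [|j IH] y b /=.
    by move=> [-> ->]; rewrite addn0 sub0r; exact: WV.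
  move=> [z [c [t [h /andP[t0 tc] [-> ->]]]]]; rewrite addnS; apply: WS.
  (* The coefficient [t] is the fraction [t / c] of the weight that is left; if nothing is left, the
     fraction is taken to be 0. *)
  have [c0|c0] := eqVneq c 0.
    exists (z - v), c, 0; split; [exact: IH|by rewrite lexx ler01|].
    have -> : t = 0 by lra.
    by rewrite mul0r scale0r !addr0.
  exists (z - v), c, (t / c); split; first exact: IH.
    have cp : 0 < c by rewrite lt_neqAle eq_sym c0 (le_trans t0).
    by rewrite divr_ge0 ?(ltW cp)//= ler_pdivrMr// mul1r.
  by rewrite mulfVK// addrAC.
have [||||||k [v [w [Vv [j h] vw]]]] := @james_close_convex _ _ U UU Y u V
    (fun k => [set w | exists j, tail_hull u k j (w, 0)]) e cofU reflY uY ub.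
- elim=> [|k IH]; first by rewrite V0 => a v w _ -> ->; rewrite !scaler0 addr0.
  by rewrite VS; exact: segment_sums_convex.
- by move=> k; rewrite VS; exact: segment_sums_sub.
- by move=> k; rewrite VS; exists 0, 1; rewrite scale1r add0r ler01 lexx.
- move=> k a v w a01 [i vi] [j wj]; exists (maxn i j).
  have := tail_hull_convex a01 (tail_hull_mono (leq_maxl i j) vi)
    (tail_hull_mono (leq_maxr i j) wj).
  by rewrite !mulr0 addr0.
(* The point [u n] arises by keeping the whole weight up to stage [n - k] and spending it there. *)
- move=> k n kn; exists (n - k).+1; exists 0, 1, 1; split.
  + by apply: (@tail_hull_mono _ _ 0%N).
  + by rewrite lexx ler01.
  + by rewrite subnKC// scale1r add0r subrr.
- exact: e0.
have := We _ _ (hullW _ _ _ _ _ Vv h).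
by rewrite distrC => /lt_trans/(_ vw); rewrite ltxx.
Qed.

End ReflexiveApproximation.

(** * Reflexivity implies conditions (a) and (b) *)

Section ConditionA.
Variables (R : realType) (X : completeNormedModType R).
Variables (N : X -> R) (c : nat -> X).
Hypothesis N_seminorm : dominated_seminorm N.
Hypothesis N_eq0 : forall x, N x = 0 -> x = 0.
Hypothesis c_dense : dense_seq c.
Hypothesis N_split : forall k, exists (a : R) (r : X -> R),
  [/\ 0 < a, dominated_seminorm r & forall x, N x = a * tilted_norm (c k) x + r x].

Lemma tilted_norm_additive (z w : X) : N (z + w) = N z + N w ->
  forall d, tilted_norm d (z + w) = tilted_norm d z + tilted_norm d w.
Proof.
move=> Nzw d; have E k : tilted_norm (c k) (z + w) =
    tilted_norm (c k) z + tilted_norm (c k) w.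
  have [a [r [a0 [rD _ _] Nr]]] := N_split k.
  have [tD _ _] := tilted_norm_seminorm (c k).
  apply/le_anti; rewrite tD/= -(ler_pM2l a0).
  by move: Nzw (rD z w); rewrite !Nr; lra.
(* [2 * K] is the total Lipschitz constant, in the tilt, of the three terms compared; the added 1
   below keeps the divisor positive. *)
pose K := `|z + w| + `|z| + `|w|; have K0 : 0 <= K by rewrite !addr_ge0.
apply/eqP; rewrite -subr_eq0 -normr_le0; apply/ler_addgt0Pl => e e0; rewrite addr0.
have e'0 : 0 < e / (2 * K + 1) by rewrite divr_gt0// ltr_wpDl// mulr_ge0.
have [k dk] := c_dense d e'0.
have dk' : (2 * K + 1) * `|d - c k| < e.
  by rewrite mulrC -ltr_pdivlMr// ltr_wpDl// mulr_ge0.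
have := tilted_norm_lip d (c k) (z + w); have := tilted_norm_lip d (c k) z.
have := tilted_norm_lip d (c k) w; rewrite E !ler_norml.
have := normr_ge0 (d - c k); move: dk'; rewrite /K.
by move=> ? ? /andP[? ?] /andP[? ?] /andP[? ?]; apply/andP; lra.
Qed.

(* Tilting towards [- (z + w)] makes the first summand of the tilted norm of
   [z + w] vanish, which forces [z] and [w] to be multiples of [z + w]. *)
Lemma odell_schlumprecht_strictly_convex (z w : X) :
  N (z + w) = N z + N w -> N z = N w -> z = w.
Proof.
move=> Nzw Nz; have T := tilted_norm_additive Nzw.
have nzw : `|z + w| = `|z| + `|w| by have := T 0; rewrite !tilted_norm0; lra.
have [st0|st0] := eqVneq (`|z| + `|w|) 0.
  have /eqP : `|z| = 0 by have := normr_ge0 z; have := normr_ge0 w; lra.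
  have /eqP : `|w| = 0 by have := normr_ge0 z; have := normr_ge0 w; lra.
  by rewrite !normr_eq0 => /eqP-> /eqP->.
pose d := - (`|z| + `|w|)^-1 *: (z + w).
have dE : (`|z| + `|w|) *: d = - (z + w).
  by rewrite /d scalerA mulrN divff// scaleN1r.
have := T d; rewrite /tilted_norm nzw dE addNr normr0 add0r => Td.
have h1 : `| - (z + w) - (z + w)| <= `| `|z| *: d - z| + `| `|w| *: d - w|.
  rewrite -[X in `|X - _|]dE scalerDl opprD addrACA; exact: ler_normD.
have /eqP : `| `|z| *: d + z| = 0.
  by have := normr_ge0 (`|z| *: d + z); have := normr_ge0 (`|w| *: d + w); lra.
have /eqP : `| `|w| *: d + w| = 0.
  by have := normr_ge0 (`|z| *: d + z); have := normr_ge0 (`|w| *: d + w); lra.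
rewrite !normr_eq0 !addr_eq0 => /eqP wd /eqP zd.
have zE : z = `|z| *: - d by rewrite scalerN zd opprK.
have wE : w = `|w| *: - d by rewrite scalerN wd opprK.
have [Nd|Nd] := eqVneq (N (- d)) 0.
  by rewrite zE wE (N_eq0 Nd) !scaler0.
have sw : `|z| = `|w|.
  by apply: (mulIf Nd); rewrite -!seminormZ// -zE -wE.
by rewrite zE sw -wE.
Qed.

Section Sequence.
Variables (Y : submodClosed X) (x : nat -> X).
Hypotheses (reflY : reflexive_space (sublmod Y)) (xY : forall n, x n \in Y).
Hypothesis x_bnd : bnd (fun n => `|x n| : R).
Hypothesis xx_ex : ex_iterated_lim (fun m n => N (x m + x n)).
Hypothesis x_cvg : cvgn (fun n => N (x n)).
Hypothesis xx_lim :
  iterated_lim (fun m n => N (x m + x n)) = 2 * limn (fun n => N (x n)).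

(** Approximating points at every scale make the image of [U] a Cauchy filter, and [X] is
    complete. *)
Lemma reflexive_ultra_cvg (U : set_system nat) : UltraFilter U -> \oo `<=` U ->
  exists z : X, x n @[n --> U] --> z.
Proof.
move=> UU cofU; have [M xM'] := x_bnd.
have xM n : `|x n| <= M by rewrite -[leLHS]normr_id.
suff : cauchy (x n @[n --> U]) by move=> /cauchy_cvg/cvg_ex.
apply/cauchyP => e e0.
have [z zx] : exists z, ulim U (fun n => `|- z + 1 *: x n|) <= e / 2.
  have e20 : 0 < e / 2 by rewrite divr_gt0.
  (* The rescaling in [ulim2_double_norm] divides by this ultralimit; when it vanishes, 0 is itself
     the approximating point. *)
  have [r0|r0] := leP (ulim U (fun n => `|x n|)) 0.
    exists 0; rewrite (_ : (fun n => _) = fun n => `|x n|).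
      exact: le_trans r0 (ltW e20).
    by apply/funext => n; rewrite oppr0 add0r scale1r.
  apply: (reflexive_type_approx UU cofU reflY xY x_bnd) => // z.
  apply: (ulim2_double_norm UU c_dense N_split) => //.
  rewrite (cvg_ulim UU cofU x_cvg) -xx_lim le_eqVlt; apply/orP; left; apply/eqP.
  exact: ex_iterated_lim_ulim.
exists z; have bz : bnd (fun n => `|- z + 1 *: x n|) by exact: type_norm_bnd xM _ _.
have : ulim U (fun n => `|- z + 1 *: x n|) < e by rewrite (le_lt_trans zx)//; lra.
move=> /(ulim_lt_near UU bz); apply: filterS => n.
by rewrite -ball_normE /= distrC scale1r addrC.
Qed.

(** All limits in the hypothesis are ordinary ones, so the outer limit may be read along [U] and the
    inner one along [W]. This gives [N (z + w) = N z + N w] with [N z = N w], and strict convexity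
    applies. *)
Lemma ultra_cvg_unique (U W : set_system nat) (z w : X) :
  UltraFilter U -> \oo `<=` U -> UltraFilter W -> \oo `<=` W ->
  x n @[n --> U] --> z -> x n @[n --> W] --> w -> z = w.
Proof.
move=> UU cofU WW cofW xz xw; have [xx1 xx2] := xx_ex.
have Nl (V : set_system nat) (v : X) : UltraFilter V -> \oo `<=` V ->
    x n @[n --> V] --> v -> N v = limn (fun n => N (x n)).
  move=> VV cofV xv; rewrite -(cvg_ulim VV cofV x_cvg).
  by rewrite (ulim_eq VV (seminorm_cvg _ N_seminorm xv)).
have Nzw : N (z + w) = 2 * limn (fun n => N (x n)).
  rewrite -xx_lim (ex_iterated_lim_ulim WW cofW xx_ex).
  have -> : (fun m => ulim W (fun n => N (x m + x n))) = (fun m => N (x m + w)).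
    apply/funext => m; apply: (ulim_eq WW); apply: seminorm_cvg => //.
    by apply: cvgD => //; exact: cvg_cst.
  have cW : cvgn (fun m => N (x m + w)).
    have -> // : (fun m => N (x m + w)) = (fun m => limn (fun n => N (x m + x n))).
    apply/funext => m; rewrite -(cvg_ulim WW cofW (xx1 m)); symmetry.
    apply: (ulim_eq WW); apply: seminorm_cvg => //.
    by apply: cvgD => //; exact: cvg_cst.
  rewrite (cvg_ulim WW cofW cW) -(cvg_ulim UU cofU cW); symmetry.
  apply: (ulim_eq UU); apply: seminorm_cvg => //.
  by apply: cvgD => //; exact: cvg_cst.
apply: odell_schlumprecht_strictly_convex.
  by rewrite Nzw (Nl _ _ UU cofU xz) (Nl _ _ WW cofW xw); ring.
by rewrite (Nl _ _ UU cofU xz) (Nl _ _ WW cofW xw).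
Qed.

Lemma reflexive_cvgn : cvgn x.
Proof.
have [U [UU cofU]] := exists_cofinite_ultrafilter.
have [z xz] := reflexive_ultra_cvg UU cofU.
suff : x n @[n --> \oo] --> z by exact: cvgP.
move=> V Vz; apply: contrapT => nV.
(* A free ultrafilter carried by the indices with [x n] outside [V] would converge to the same [z],
   which is absurd. *)
pose F := within [set n | ~ V (x n)] \oo.
have PF : ProperFilter F.
  apply: Build_ProperFilter => - [n _ nF]; apply: nV; exists n => // m nm.
  by apply: contrapT => Vm; exact: nF nm Vm.
have [W [WW FW]] := ultraFilterLemma PF.
have cofW : \oo `<=` W by move=> A A_oo; apply/FW; apply: filterS A_oo => n An _.
have [w xw] := reflexive_ultra_cvg WW cofW.
have zw := ultra_cvg_unique UU cofU WW cofW xz xw.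
have WV : W (x @^-1` V) by apply: xw; rewrite -zw.
have WnV : W [set n | ~ V (x n)] by apply: FW; exists 0%N => // n _.
have [n [Vn nVn]] := filter_ex (filterI WV WnV).
exact: nVn Vn.
Qed.

End Sequence.
End ConditionA.

Section ConditionB.
Variables (R : realType) (X : normedModType R).
Variables (N : X -> R) (c : nat -> X).
Hypothesis c_dense : dense_seq c.
Hypothesis N_split : forall k, exists (a : R) (r : X -> R),
  [/\ 0 < a, dominated_seminorm r & forall x, N x = a * tilted_norm (c k) x + r x].
Variables (Y : submodClosed X) (x : nat -> X).
Hypotheses (reflY : reflexive_space (sublmod Y)) (xY : forall n, x n \in Y).
Hypothesis x_bnd : bnd (fun n => `|x n| : R).
Hypothesis x_weak : weakly_null x.

Let xM : exists M, forall n, `|x n| <= M.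
Proof. by have [M h] := x_bnd; exists M => n; rewrite -[leLHS]normr_id. Qed.

Section FixedUltrafilter.
Variable U : set_system nat.
Hypothesis (UU : UltraFilter U) (cofU : \oo `<=` U).

(** A functional below [p] that attains [p z] is continuous, so it tends to 0 along [x] and does not
    see the added terms. *)
Lemma weakly_null_lsc p z (s : R) : dominated_seminorm p ->
  p z <= ulim U (fun n => p (z + s *: x n)).
Proof.
move=> ps; have [pD pZ [C pC]] := ps.
have psub : sublinear p by split=> // a y; exact: seminormZ.
have [f [lf fp fz]] := sublinear_norming z psub.
have [|g gf] := @bounded_functional_dual R X f C.
  by apply: le_norm_bound_functional => // y; exact: le_trans (fp y) (pC y).
have fx : f (x n) @[n --> \oo] --> (0 : R).
  rewrite (_ : (fun n => f (x n)) = fun n => g (x n)); first exact: x_weak.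
  by apply/funext => n; rewrite gf.
have bfx : bnd (fun n => f (x n)) by apply: bnd_cvgn; exact: cvgP fx.
have [M xm] := xM.
have bz : bnd (fun n => `|z + s *: x n|) by exact: type_norm_bnd xm _ _.
rewrite -fz (_ : f z = ulim U (fun n => f z + s * f (x n))); last first.
  rewrite ulimD//; [|exact: bnd_cst|exact: bndZ].
  by rewrite ulim_cst// ulimZ// (cvg_ulim UU cofU fx) mulr0 addr0.
apply: (ulim_le UU).
- by apply: bndD; [exact: bnd_cst|exact: bndZ].
- exact: (bnd_seminorm bz ps).
- by move=> n; rewrite -(linear_combZ lf) -(linear_combD lf).
Qed.

Hypothesis x_pos : 0 < ulim U (fun n => `|x n|).
Hypothesis N_le : ulim2 U (fun m n => N (x m + x n)) <= ulim U (fun n => N (x n)).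

(** Adding a term leaves the type unchanged in the limit; this is what keeps the partial sums of the
    selected terms bounded. *)
Lemma type_norm_shift (z : X) :
  ulim U (fun m => type_norm U x (z + x m) 1) = type_norm U x z 1.
Proof.
have := ulim2_shift_norm UU c_dense N_split x_bnd z x_pos N_le.
have -> : ulim U (fun n => `|z + x n|) = type_norm U x z 1.
  by congr ulim; apply/funext => n; rewrite scale1r.
move=> <-.
  congr ulim; apply/funext => m; congr ulim; apply/funext => n.
  by rewrite scale1r addrA.
move=> p y ps; have := weakly_null_lsc y 1 ps.
by rewrite (_ : (fun n => p (y + 1 *: x n)) = fun n => p (y + x n))//;
  apply/funext => n; rewrite scale1r.
Qed.

Let r := ulim U (fun n => `|x n|).

(** The ultralimit is at least the norm of [v], and at least [r] minus that norm, hence at least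
    [r / 2]; the constant [r / 4] makes the bound strict. *)
Lemma norm_add_lower (v : X) : r / 4 < ulim U (fun n => `|v + x n|).
Proof.
have [M xm] := xM.
have bv : bnd (fun n => `|v + x n| : R) by exact: bnd_normD.
have h1 : `|v| <= ulim U (fun n => `|v + x n|).
  have := weakly_null_lsc v 1 (norm_seminorm X).
  by rewrite (_ : (fun n => `|v + 1 *: x n|) = fun n => `|v + x n|)//;
    apply/funext => n; rewrite scale1r.
have h2 : r <= ulim U (fun n => `|v + x n|) + `|v|.
  rewrite -[X in _ + X](ulim_cst UU) -ulimD//; last exact: bnd_cst.
  apply: (ulim_le UU) => //; first by apply: bndD => //; exact: bnd_cst.
  move=> n; rewrite -[in leLHS](addKr v (x n)) (le_trans (ler_normD _ _))//.
  by rewrite normrN addrC.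
by have := x_pos; rewrite -/r; lra.
Qed.

Lemma segment_sums_lower (W : set X) (e : R) : compact W ->
  (forall w, W w -> e < `|w|) ->
  \forall m \near U, forall w, segment_sums W (x m) w -> e < `|w|.
Proof.
move=> cW We; have [M xm] := xM; have M0 : 0 <= M := le_trans (normr_ge0 _) (xm 0%N).
suff : \forall m \near U, forall z : X * R, (W `*` `[0, 1]%classic) z ->
    e < `|z.1 + z.2 *: x m|.
  apply: filterS => m h _ [w [s [Ww s01 ->]]].
  by apply: (h (w, s)); split => //=; rewrite in_itv.
apply: (@compact_uniform_gt R U UU _ _ _
  (fun z z' : X * R => `|z.1 - z'.1| + `|z.2 - z'.2| * M)).
- exact: compact_setX cW (@segment_compact R 0 1).
- by move=> [w s] _; exact: type_norm_bnd xm _ _.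
- move=> m z z'; rewrite lerBlDr -[z.1 + _](subrK (z'.1 + z'.2 *: x m)).
  rewrite (le_trans (ler_normD _ _))// addrC lerD2l opprD addrACA -scalerBl.
  by rewrite (le_trans (ler_normD _ _))// lerD2l normrZ ler_wpM2l.
- move=> z; rewrite (_ : 0 = `|z.1 - z.1| + `|z.2 - z.2| * M); last first.
    by rewrite !subrr !normr0 mul0r addr0.
  apply: cvgD; last apply: cvgMl.
    by apply: cvg_norm; apply: cvgB; [exact: cvg_cst|exact: cvg_fst].
  by apply: cvg_norm; apply: cvgB; [exact: cvg_cst|exact: cvg_snd].
- move=> [w s] [Ww _] /=; rewrite (lt_le_trans (We _ Ww))//.
  exact: weakly_null_lsc (norm_seminorm X).
Qed.

Lemma translate_lower (V : set X) : compact V ->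
  \forall m \near U, forall v, V v -> r / 4 < `|v + x m|.
Proof.
move=> cV.
apply: (@compact_uniform_gt R U UU _ _ _ (fun z z' : X => `|z - z'|)) => //.
- by move=> v _; exact: bnd_normD.
- move=> m z z'; rewrite lerBlDr -[z + _](subrK (z' + x m)).
  by rewrite (le_trans (ler_normD _ _))// addrC lerD2l opprD addrACA subrr addr0.
- move=> z; rewrite (_ : 0 = `|z - z|); last by rewrite subrr normr0.
  by apply: cvg_norm; apply: cvgB; [exact: cvg_cst|exact: cvg_id].
- by move=> v _; exact: norm_add_lower.
Qed.

(* [S k] is the sum of the [u i], [i < k]; [V k] is the set of such sums with
   coefficients in [0, 1], and [W k] contains those with some coefficient 1. *)
Lemma bounded_partial_sums :
  exists (u : nat -> X) (V W : nat -> set X) (S : nat -> X),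
    [/\ forall k, u k \in Y, V 0%N = [set 0], S 0%N = 0 &
        bnd (fun k => `|S k| : R)] /\
    [/\ forall k, V k.+1 = segment_sums (V k) (u k),
        forall k, S k.+1 = S k + u k,
        forall k v, V k v -> W k.+1 (v + u k),
        forall k, segment_sums (W k) (u k) `<=` W k.+1 &
        forall k w, W k w -> r / 4 < `|w|].
Proof.
have [M xm] := xM.
pose step (S : set X * set X * X) m := (segment_sums S.1.1 (x m),
  segment_sums S.1.2 (x m) `|` [set v + x m | v in S.1.1], S.2 + x m).
(* The partial sum is controlled through its [type_norm], whose strict bound survives a suitable
   next term by [type_norm_shift]; it starts at [r], hence [r + 1]. Lower semicontinuity then bounds
   the norm itself. *)
pose good (S : set X * set X * X) := [/\ compact S.1.1, compact S.1.2,
  forall w, S.1.2 w -> r / 4 < `|w| & type_norm U x S.2 1 < r + 1].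
have [||phi [st [st0 stg stS]]] :=
    @iterated_selection _ step good ([set 0], set0, 0).
- split; [exact: compact_set1|exact: compact0|by []|].
  rewrite /type_norm (_ : (fun n => _) = fun n => `|x n|) ?ltrDl//.
  by apply/funext => n; rewrite add0r scale1r.
- move=> [[V W] S] [/= cV cW We SC].
  have bS : bnd (fun m => type_norm U x (S + x m) 1).
    by apply: (bnd_type_norm UU xm); exact: bnd_normD.
  have := SC; rewrite -type_norm_shift => /(ulim_lt_near UU bS) nS.
  have := filter_ex (filterI nS
    (filterI (segment_sums_lower cW We) (translate_lower cV))).
  move=> [m [Sm [Wm Vm]]]; exists m; split => //=.
  + exact: segment_sums_compact.
  + apply: compactU; first exact: segment_sums_compact.
    apply: continuous_compact cV; apply: continuous_subspaceT => v.
    by apply: cvgD; [exact: cvg_id|exact: cvg_cst].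
  + by move=> w [/Wm//|[v Vv <-]]; exact: Vm.
exists (x \o phi), (fun k => (st k).1.1), (fun k => (st k).1.2), (fun k => (st k).2).
split; split.
- by move=> k; exact: xY.
- by rewrite st0.
- by rewrite st0.
- exists (r + 1) => k; rewrite normr_id; have [_ _ _ /ltW] := stg k.
  exact: le_trans (weakly_null_lsc _ 1 (norm_seminorm X)).
- by move=> k; rewrite stS.
- by move=> k; rewrite stS.
- by move=> k v Vv; rewrite stS; right; exists v.
- by move=> k w; rewrite stS; left.
- by move=> k w Ww; have [_ _ /(_ _ Ww)] := stg k.
Qed.

Fixpoint tail_sums (u : nat -> X) k j : set X :=
  if j is i.+1 then segment_sums (tail_sums u k i) (u (k + i)%N) else [set 0].

Lemma tail_sums_convex u k j : is_convex (tail_sums u k j).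
Proof.
elim: j => [|j IH] /=; last exact: segment_sums_convex.
by move=> a v w _ -> ->; rewrite !scaler0 addr0.
Qed.

Lemma tail_sums_mono u k i j : (i <= j)%N -> tail_sums u k i `<=` tail_sums u k j.
Proof.
elim: j => [|j IH]; first by rewrite leqn0 => /eqP ->.
rewrite leq_eqVlt ltnS => /predU1P[->//|/IH{}IH v /IH].
exact: segment_sums_sub.
Qed.

(* A convex combination of [S k.+1], [S k.+2], ... minus one of [S 0], ..., [S k]
   lies in some [W], hence is not small, although [S] is bounded. *)
Lemma no_weakly_null_absorption : False.
Proof.
have [u [V [W [S [[uY V0 S0 bS] [VS SS VW WS We]]]]]] := bounded_partial_sums.
have r40 : 0 < r / 4 by rewrite divr_gt0.
have SY k : S k \in Y by elim: k => [|k IH]; rewrite ?S0 ?rpred0// SS rpredD.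
(* Replacing each coefficient [s] by [1 - s] preserves [V k]. Hence [S k.+1 + z - v] is a sum whose
   coefficient at [u k] is 1, the kind of sum that [W] keeps away from 0. *)
have VrefS k v : V k v -> V k (S k - v).
  elim: k v => [|k IH] v; first by rewrite V0 S0 => ->; rewrite subrr.
  rewrite VS SS => -[w [s [Vw s01 ->]]]; exists (S k - w), (1 - s); split.
  - exact: IH.
  - by move: s01 => /andP[? ?]; apply/andP; lra.
  - by rewrite opprD addrACA scalerBl scale1r.
have Wtail k j v z : V k v -> tail_sums u k.+1 j z -> W (k.+1 + j)%N (v + u k + z).
  move=> Vv; elim: j z => [|j IH] z /=.
    by move=> ->; rewrite addn0 addr0; exact: VW.
  move=> [y [s [ty s01 ->]]]; rewrite addnS; apply: WS.
  by exists (v + u k + y), s; split; [exact: IH| |rewrite addrA].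
pose B k := [set S k.+1 + z | z in \bigcup_j tail_sums u k.+1 j].
have [||||||||k [v [_ [Vv [z [j _ tz] <-] vz]]]] := @james_close_convex _ _ U UU Y
    (fun k => S k.+1) V B (r / 4) cofU reflY.
- by move=> k; exact: SY.
- by have [K h] := bS; exists K => k; exact: h.
- elim=> [|k IH]; first by rewrite V0 => a v w _ -> ->; rewrite !scaler0 addr0.
  by rewrite VS; exact: segment_sums_convex.
- by move=> k; rewrite VS; exact: segment_sums_sub.
- move=> k; elim: k.+1 => [|{}k IH]; first by rewrite V0 S0.
  by rewrite VS SS; exists (S k), 1; rewrite scale1r lexx ler01.
- move=> k a _ _ a01 [y [i _ ty] <-] [z [j _ tz] <-].
  exists (a *: y + (1 - a) *: z); last first.
    by rewrite !scalerDr addrACA -scalerDl (addrC a) subrK scale1r.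
  exists (maxn i j) => //; apply: tail_sums_convex => //.
    by apply: tail_sums_mono ty; exact: leq_maxl.
  by apply: tail_sums_mono tz; exact: leq_maxr.
- move=> k n kn; exists (S n.+1 - S k.+1); last by rewrite addrC subrK.
  exists (n - k)%N => //; rewrite -[in S n.+1](subnKC kn).
  elim: (n - k)%N => [|j IH]; first by rewrite addn0 subrr.
  exists (S (k + j).+1 - S k.+1), 1; rewrite lexx ler01 scale1r; split => //.
  by rewrite addnS SS addrAC.
- exact: r40.
have := We _ _ (Wtail _ _ _ _ (VrefS _ _ Vv) tz).
rewrite -normrN (_ : - (S k - v + u k + z) = v - (S k.+1 + z)); last first.
  by rewrite (addrAC (S k)) (addrAC (S k + u k)) opprB SS.
by move=> /lt_trans/(_ vz); rewrite ltxx.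
Qed.

End FixedUltrafilter.

Lemma reflexive_condition_b : ~ (x n @[n --> \oo] --> (0 : X)) ->
  ex_iterated_lim (fun m n => N (x m + x n)) -> cvgn (fun m => N (x m)) ->
  limn (fun m => N (x m)) < iterated_lim (fun m n => N (x m + x n)).
Proof.
move=> nx0 xx_ex x_cvg; rewrite ltNge; apply/negP => Nle.
have [e e0 nV] : exists2 e : R, 0 < e & ~ \forall n \near \oo, `|x n| < e.
  apply: contrapT => H; apply: nx0; apply/cvgrPdist_lt => e e0.
  apply: contrapT => He; apply: H; exists e => // He'; apply: He.
  by apply: filterS He' => n; rewrite sub0r normrN.
(* Restricting to indices where the norm is at least [e] makes its ultralimit positive, as the
   rescaling by its inverse requires. *)
pose F := within [set n | ~ (`|x n| < e)] \oo.
have PF : ProperFilter F.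
  apply: Build_ProperFilter => - [n _ nF]; apply: nV; exists n => // m nm.
  by apply: contrapT => Vm; exact: nF nm Vm.
have [U [UU FU]] := ultraFilterLemma PF.
have cofU : \oo `<=` U by move=> A A_oo; apply: FU; apply: filterS A_oo => n An _.
have Ue : \forall n \near U, e <= `|x n|.
  by apply: FU; exists 0%N => // n _ /negP; rewrite -leNgt.
apply: (no_weakly_null_absorption UU cofU).
  rewrite (lt_le_trans e0)// -(ulim_cst UU e); apply: (le_ulim UU) => //.
  exact: bnd_cst.
have := Nle; rewrite (ex_iterated_lim_ulim UU cofU xx_ex).
by rewrite -(cvg_ulim UU cofU x_cvg).
Qed.

End ConditionB.

(** * Condition (a) implies reflexivity *)

Section Converse.
Variables (R : realType) (V : normedModType R).
Variables (n : V -> R).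
Hypothesis n_seminorm : dominated_seminorm n.
Hypothesis n_lb : exists2 b : R, 0 < b & forall y, b * `|y| <= n y.
Implicit Types (f g h : dual V) (y z : V).

Lemma dualDE f g y : (f + g) y = f y + g y. Proof. by []. Qed.

Lemma dualZE (a : R) f y : (a *: f) y = a * f y. Proof. by []. Qed.

Lemma dual_sumE (I : Type) (s : seq I) (a : I -> R) (f : I -> dual V) y :
  (\sum_(i <- s) a i *: f i) y = \sum_(i <- s) a i * f i y.
Proof.
elim: s => [|i s IH]; first by rewrite !big_nil.
by rewrite !big_cons dualDE IH.
Qed.

Lemma linear_sumE (W : lmodType R) (p : W -> R^o) (I : Type) (s : seq I)
    (a : I -> R) (w : I -> W) : linear p ->
  p (\sum_(i <- s) a i *: w i) = \sum_(i <- s) a i * p (w i).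
Proof.
move=> lp; elim: s => [|i s IH]; first by rewrite !big_nil linear_comb0.
by rewrite !big_cons lp IH.
Qed.

Variable Phi : dual (dual V).

Let Phi_lin : linear Phi. Proof. by have [] := dualP Phi. Qed.

Definition sub_norm f := forall y, f y <= n y.

(** The norm of [Phi] in the bidual of the space normed by [n]; absolute values can be omitted
    because [sub_norm] is symmetric. *)
Definition bidual_norm : R := sup [set Phi f | f in sub_norm].
Local Notation M := bidual_norm.

Lemma sub_norm_has_sup : has_sup [set Phi f | f in sub_norm].
Proof.
split.
  exists (Phi 0), 0 => // y; exact: seminorm_ge0.
have [_ _ [C nC]] := n_seminorm; exists (`|Phi| * `|C|) => _ [f fn <-].
rewrite (le_trans (ler_norm _))// (le_trans (dual_le _ _))// ler_wpM2l//.
rewrite dual_normE; apply: dual_norm_le => y y1.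
have nyC w : `|w| <= 1 -> n w <= `|C|.
  move=> w1; rewrite (le_trans (nC w))// (@le_trans _ _ (`|C| * `|w|))//.
    by rewrite ler_wpM2r// ler_norm.
  by rewrite ler_piMr.
have [lf _] := dualP f; rewrite ler_norml (le_trans (fn y) (nyC _ y1)) andbT.
by rewrite lerNl -(linear_combN lf) (le_trans (fn _))// nyC// normrN.
Qed.

Lemma bidual_norm_ub f : sub_norm f -> Phi f <= M.
Proof. by move=> fn; apply: ub_le_sup; [exact: sub_norm_has_sup.2|exists f]. Qed.

Lemma bidual_norm_ge0 : 0 <= M.
Proof.
rewrite -(linear_comb0 Phi_lin) bidual_norm_ub// => y; exact: seminorm_ge0.
Qed.

Lemma bidual_norm_scale h (t : R) : 0 <= t -> (forall y, h y <= t * n y) ->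
  Phi h <= t * M.
Proof.
move=> t0 ht; have [lh _] := dualP h.
have [t00|tn0] := eqVneq t 0.
  have -> : h = 0.
    apply/val_inj/funext => y /=; apply/le_anti.
    have := ht y; have := ht (- y); rewrite t00 !mul0r (linear_combN lh) oppr_le0.
    by move=> -> ->.
  by rewrite (linear_comb0 Phi_lin) t00 mul0r.
have tp : 0 < t by rewrite lt_neqAle eq_sym tn0.
rewrite -ler_pdivrMl// -(linear_combZ Phi_lin); apply: bidual_norm_ub => y.
by rewrite dualZE ler_pdivrMl.
Qed.

(** Goldstine's theorem for finitely many functionals, by separation in R^k of the image of a ball
    from the values of [Phi]. The radius [M + d] stays positive even when [M] is 0. *)
Lemma goldstine_approx k (f : 'I_k -> dual V) (e d : R) : 0 < e -> 0 < d ->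
  exists y, n y <= M + d /\ forall i, `|f i y - Phi (f i)| < e.
Proof.
move=> e0 d0; apply: contrapT => nP; have M0 := bidual_norm_ge0.
have Md0 : 0 < M + d by rewrite ltr_wpDl.
pose T y : 'rV[R]_k := \row_i f i y; pose z : 'rV[R]_k := \row_i Phi (f i).
have TE (a b : R) y w : T (a *: y + b *: w) = a *: T y + b *: T w.
  apply/rowP => i; rewrite !mxE; have [lf _] := dualP (f i).
  by rewrite lf (linear_combZ lf).
have [nD _ _] := n_seminorm.
have n0 : n 0 = 0 by rewrite -(scale0r 0) (seminormZ _ n_seminorm (lexx 0)) mul0r.
have [||v|p [[lp _] pT]] := @convex_separation R 'rV[R]_k
    [set T y | y in [set y | n y <= M + d]] z e.
- move=> a _ _ /andP[a0 a1] [y ny <-] [w nw <-].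
  have a1' : 0 <= 1 - a by rewrite subr_ge0.
  exists (a *: y + (1 - a) *: w) => //=; rewrite (le_trans (nD _ _))//.
  rewrite (seminormZ _ n_seminorm a0) (seminormZ _ n_seminorm a1').
  have h1 : a * n y <= a * (M + d) by rewrite ler_wpM2l.
  have h2 : (1 - a) * n w <= (1 - a) * (M + d) by rewrite ler_wpM2l.
  lra.
- by exists (T 0), 0 => //=; rewrite n0 ltW.
- move=> [y ny <-]; rewrite leNgt; apply/negP => Tz; apply: nP.
  exists y; split => // i; apply: le_lt_trans Tz.
  rewrite [leRHS]/Num.norm/= mx_normrE; apply/bigmax_geP; right => /=.
  by exists (0, i); rewrite //= !mxE.
(* The separating [p] is bounded below on the image of the ball; the sign makes [h] bounded above
   there. *)
pose c i := - p (delta_mx 0 i); pose h := \sum_(i < k) c i *: f i.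
have hE y : h y = - p (T y).
  rewrite dual_sumE [T y]row_sum_delta (linear_sumE _ _ _ lp) -sumrN.
  by apply: eq_bigr => i _; rewrite mxE /c mulNr mulrC.
have PhE : Phi h = - p z.
  rewrite (linear_sumE _ _ _ Phi_lin) [z]row_sum_delta (linear_sumE _ _ _ lp).
  by rewrite -sumrN; apply: eq_bigr => i _; rewrite mxE /c mulNr mulrC.
have hle y : n y <= M + d -> h y <= Phi h - e.
  move=> ny; rewrite hE PhE -opprD lerN2; apply: pT; by exists y.
have [lh _] := dualP h.
(* This bounds the dual norm of [h], so [Phi h] is at most [t * M], which does not exceed
   [Phi h - e]. *)
pose t := (Phi h - e) / (M + d).
have t0 : 0 <= Phi h - e by rewrite -(linear_comb0 lh) hle// n0 ltW.
have := @bidual_norm_scale h t; rewrite divr_ge0 ?(ltW Md0)// => /(_ isT) ht.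
have : Phi h <= Phi h - e.
  rewrite (le_trans (ht _))//; last first.
    by rewrite /t mulrAC ler_pdivrMr// ler_wpM2l// lerDl ltW.
  move=> y; have [ny|ny] := eqVneq (n y) 0.
    have [b b0 nb] := n_lb; have := nb y; rewrite ny pmulr_rle0// normr_le0.
    by move=> /eqP ->; rewrite (linear_comb0 lh) mulr0.
  have nyp : 0 < n y by rewrite lt_neqAle eq_sym ny seminorm_ge0.
  have a0 : 0 < (M + d) / n y by rewrite divr_gt0.
  have := hle (((M + d) / n y) *: y).
  rewrite (seminormZ _ n_seminorm (ltW a0)) mulfVK// lexx => /(_ isT).
  rewrite (linear_combZ lh) => hy; rewrite -ler_pdivrMr// ler_pdivlMr//.
  by rewrite (_ : _ * _ = (M + d) / n y * h y)//; ring.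
lra.
Qed.

Lemma norming_sequence : exists F : nat -> dual V,
  forall k, sub_norm (F k) /\ M - k.+1%:R^-1 < Phi (F k).
Proof.
have E k : exists f, sub_norm f /\ M - k.+1%:R^-1 < Phi f.
  have k0 : 0 < k.+1%:R^-1 :> R by rewrite invr_gt0.
  by have [_ [f fn <-] fM] := sup_adherent k0 sub_norm_has_sup; exists f.
by have [F FP] := choice E; exists F.
Qed.

End Converse.

(** Condition (a) needs ordinary limits. The next index is chosen close to the ultralimit in all
    rows already selected, with a tolerance that shrinks with their number; only selected rows have
    to converge. *)
Lemma diagonal_ultralimit (R : realType) (U : set_system nat)
    (w : nat -> nat -> R) : UltraFilter U -> \oo `<=` U -> bnd2 w ->
  exists phi : nat -> nat, (forall k, (k <= phi k)%N) /\
    forall j, w (phi j) (phi k) @[k --> \oo] --> ulim U (w (phi j)).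
Proof.
move=> UU cofU bw.
pose close (s : seq nat) m := forall j, j \in s ->
  `|w j m - ulim U (w j)| < (size s).+1%:R^-1.
pose good (s : seq nat) := if s is m :: s' then (size s' <= m)%N /\ close s' m
  else True.
have ex_close s : \forall m \near U, close s m.
  suff : forall s' : seq nat, \forall m \near U, forall j, j \in s' ->
      `|w j m - ulim U (w j)| < (size s).+1%:R^-1 by exact.
  elim=> [|i s' IH]; first by apply: filterE => m j; rewrite in_nil.
  have /cvgrPdist_lt/(_ (size s).+1%:R^-1) := ulim_cvg UU (bnd2_bnd i bw).
  rewrite invr_gt0 => /(_ (ltr0Sn _ _)) Pi.
  apply: filterS (filterI Pi IH) => m [im sm] j; rewrite in_cons => /predU1P[->|/sm//].
  by rewrite distrC.
have [//|s gs|phi [st [st0 stg stS]]] :=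
    @iterated_selection _ (fun s m => m :: s) good [::].
  have ge_s : \forall m \near U, (size s <= m)%N by apply: cofU; exists (size s).
  by have [m [? ?]] := filter_ex (filterI ge_s (ex_close s)); exists m.
have size_st k : size (st k) = k by elim: k => [|k IH]; rewrite ?st0// stS/= IH.
have mem_st j k : (j < k)%N -> phi j \in st k.
  elim: k => [//|k IH]; rewrite ltnS leq_eqVlt stS in_cons.
  by move=> /predU1P[->|/IH ->]; rewrite ?eqxx ?orbT.
exists phi; split.
  by move=> k; have := stg k.+1; rewrite stS /= size_st => -[].
move=> j; apply/cvgrPdist_lt => e e0; near=> k.
have := stg k.+1; rewrite stS /= => -[_ /(_ (phi j))].
rewrite mem_st; last by near: k; exists j.+1.
move=> /(_ isT); rewrite size_st distrC => /lt_trans; apply.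
by near: k; exact: (near_infty_natSinv_lt (PosNum e0)).
Unshelve. all: by end_near. Qed.

Section ConditionAReflexive.
Variables (R : realType) (V : normedModType R).
Variables (n : V -> R).
Hypothesis n_seminorm : dominated_seminorm n.
Hypothesis n_lb : exists2 b : R, 0 < b & forall y, b * `|y| <= n y.
Hypothesis n_cond : forall y : V^nat, bnd (fun k => `|y k| : R) -> condition_a n y.
Variable Phi : dual (dual V).
Variable F : nat -> dual V.
Local Notation M := (bidual_norm n Phi).
Hypothesis FP : forall k, sub_norm n (F k) /\ M - k.+1%:R^-1 < Phi (F k).

Let e (k : nat) : R := k.+1%:R^-1.

Let e_le j k : (j <= k)%N -> e k <= e j.
Proof. by move=> jk; rewrite lef_pV2 ?posrE// ler_nat. Qed.

Let e_gt0 k : 0 < e k. Proof. by rewrite invr_gt0. Qed.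

Let cvg_e (a : R) : (a * e k) @[k --> \oo] --> (0 : R).
Proof. by rewrite -(mulr0 a); apply: cvgMr; exact: cvg_harmonic. Qed.

Lemma norming_approximants (g : dual V) : exists y : nat -> V, forall k,
  [/\ n (y k) <= M + e k, `|g (y k) - Phi g| < e k &
      forall i, (i <= k)%N -> `|F i (y k) - Phi (F i)| < e k].
Proof.
suff E k : exists y, [/\ n y <= M + e k, `|g y - Phi g| < e k &
      forall i, (i <= k)%N -> `|F i y - Phi (F i)| < e k].
  by have [y yP] := choice E; exists y.
(* Position 0 holds [g] and position [j.+1] holds [F j], which makes [k.+2] functionals for [g] and
   [F 0] up to [F k]. *)
have [y [ny yP]] := @goldstine_approx _ _ _ n_seminorm n_lb Phi k.+2
  (fun i => if i : nat is j.+1 then F j else g) (e k) (e k) (e_gt0 k) (e_gt0 k).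
exists y; split => //; first exact: (yP ord0).
move=> i ik; have ik2 : (i.+1 < k.+2)%N by rewrite !ltnS.
exact: (yP (Ordinal ik2)).
Qed.

(** For late terms, [F j] is nearly [M] on both [v j] and [v k] and is dominated by [n], so
    [n (v j + v k)] is squeezed towards [2 * M] while [n (v k)] tends to [M]: the equality demanded
    by (a). *)
Lemma norming_limit (g : dual V) : exists z,
  [/\ Phi g = g z, n z = M & forall i, Phi (F i) = F i z].
Proof.
have [y yP] := norming_approximants g; have [nD _ _] := n_seminorm.
have [U [UU cofU]] := exists_cofinite_ultrafilter.
have [b b0 nb] := n_lb.
have M0 : 0 <= M := bidual_norm_ge0 n_seminorm Phi.
have e1 k : e k <= 1 by rewrite (le_trans (e_le (leq0n k)))// /e invr1.
have by_ : bnd (fun k => `|y k| : R).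
  exists ((M + 1) / b) => k; rewrite normr_id ler_pdivlMr// mulrC.
  rewrite (le_trans (nb _))//; have [ny _ _] := yP k.
  by rewrite (le_trans ny)// lerD2l.
have [phi [phik wlim]] := diagonal_ultralimit UU cofU
  (seminorm_bnd2 n_seminorm (bnd2_sumseq by_)).
pose v k := y (phi k).
have bv : bnd (fun k => `|v k| : R).
  by have [K h] := by_; exists K => k; exact: h.
have ephi k : e (phi k) <= e k by exact: e_le.
have v_ub k : n (v k) <= M + e k.
  by have [h _ _] := yP (phi k); rewrite (le_trans h)// lerD2l.
have v_g k : `|g (v k) - Phi g| < e k.
  by have [_ h _] := yP (phi k); rewrite (lt_le_trans h).
have v_F i k : (i <= k)%N -> `|F i (v k) - Phi (F i)| < e k.
  move=> ik; have [_ _ h] := yP (phi k).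
  by rewrite (lt_le_trans (h _ _))// (leq_trans ik).
(* One [e i] is the defect of [F i] in norming [Phi]; the other covers the approximation error
   [e k]. *)
have v_lb i k : (i <= k)%N -> M - 2 * e i < F i (v k).
  move=> ik; have [_ h1] := FP i; have h2 := v_F _ _ ik.
  have := e_le ik; move: h1 h2; rewrite ltr_norml -/(e i) => h1 /andP[h2 _]; lra.
have n_lim : n (v k) @[k --> \oo] --> M.
  apply: (@squeeze_cvgr _ _ _ _ (fun k => M - 2 * e k) (fun k => M + 1 * e k)).
  - apply: nearW => k; rewrite mul1r v_ub andbT.
    by rewrite (le_trans (ltW (v_lb _ _ (leqnn k))))// (FP k).1.
  - rewrite -[X in _ --> X]subr0; apply: cvgB; [exact: cvg_cst|exact: cvg_e].
  - rewrite -[X in _ --> X]addr0; apply: cvgD; [exact: cvg_cst|exact: cvg_e].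
have l_lim : ulim U (fun k => n (v j + y k)) @[j --> \oo] --> 2 * M.
  have bd j : 2 * M - 4 * e j <= ulim U (fun k => n (v j + y k)) <= 2 * M + 2 * e j.
    have wj := wlim j; rewrite -(cvg_lim (@norm_hausdorff _ _) wj).
    have [lF _] := dualP (F j).
    apply/andP; split.
      apply: limr_ge; first exact: cvgP wj.
      exists j => // k /= jk; rewrite (le_trans _ ((FP j).1 _))//.
      rewrite (linear_combD lF); have := v_lb _ _ (leqnn j); have := v_lb _ _ jk.
      by rewrite /v; lra.
    apply: limr_le; first exact: cvgP wj.
    exists j => // k /= jk; rewrite (le_trans (nD _ _))//.
    by have := v_ub j; have := v_ub k; have := e_le jk; rewrite /v; lra.
  apply: (@squeeze_cvgr _ _ _ _ (fun j => 2 * M - 4 * e j)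
    (fun j => 2 * M + 2 * e j)).
  - exact: nearW.
  - rewrite -[X in _ --> X]subr0; apply: cvgB; [exact: cvg_cst|exact: cvg_e].
  - rewrite -[X in _ --> X]addr0; apply: cvgD; [exact: cvg_cst|exact: cvg_e].
have inner j : limn (fun k => n (v j + v k)) = ulim U (fun k => n (v j + y k)).
  exact: (cvg_lim (@norm_hausdorff _ _) (wlim j)).
have innerE : (fun j => limn (fun k => n (v j + v k))) =
    (fun j => ulim U (fun k => n (v j + y k))) by apply/funext.
have /cvg_ex[z vz] : cvgn v.
  apply: (n_cond bv).
  - split; first by move=> j; exact: cvgP (wlim j).
    by rewrite innerE; exact: cvgP l_lim.
  - exact: cvgP n_lim.
  - rewrite /iterated_lim innerE (cvg_lim (@norm_hausdorff _ _) l_lim).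
    by rewrite (cvg_lim (@norm_hausdorff _ _) n_lim).
have uniq (f : dual V) : (\forall k \near \oo, `|f (v k) - Phi f| < e k) ->
    Phi f = f z.
  move=> fk; have [_ cf] := dualP f.
  have fz : f (v k) @[k --> \oo] --> f z.
    exact: (cvg_comp _ _ vz (cf z)).
  have fPhi : f (v k) @[k --> \oo] --> Phi f.
    apply/cvgrPdist_lt => d d0; near=> k.
    rewrite distrC; apply: (@lt_trans _ _ (e k)); first by near: k.
    by near: k; exact: (near_infty_natSinv_lt (PosNum d0)).
  exact: (cvg_unique (@norm_hausdorff _ _) fPhi fz).
exists z; split.
- by apply: uniq; apply: nearW.
- have nz : n (v k) @[k --> \oo] --> n z by exact: seminorm_cvg n_seminorm vz.
  exact: (cvg_unique (@norm_hausdorff _ _) nz n_lim).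
- by move=> i; apply: uniq; exists i => // k /= ik; exact: v_F.
Unshelve. all: by end_near. Qed.

Lemma norming_point_unique z w : n z = M -> n w = M ->
  (forall i, Phi (F i) = F i z) -> (forall i, Phi (F i) = F i w) -> z = w.
Proof.
move=> nz nw Fz Fw; have [nD _ _] := n_seminorm.
pose a k := if odd k then z else w.
have na k : n (a k) = M by rewrite /a; case: ifP.
have Fa i k : Phi (F i) = F i (a k) by rewrite /a; case: ifP.
(* Each [F i] takes the value [2 * Phi (F i)] at this sum, which comes arbitrarily close to
   [2 * M]. *)
have naa j k : n (a j + a k) = 2 * M.
  apply/le_anti/andP; split.
    by rewrite (le_trans (nD _ _))// !na; lra.
  suff : forall d : R, 0 < d -> 2 * M <= n (a j + a k) + d.
    by move=> h; apply/ler_addgt0Pr.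
  move=> d d0; have [i _ /(_ i (leqnn i)) di] :=
    near_infty_natSinv_lt (PosNum (divr_gt0 d0 (ltr0Sn R 1))).
  have [lF _] := dualP (F i); have [Fn FM] := FP i.
  have := Fn (a j + a k); rewrite (linear_combD lF) -!Fa.
  have {}di : e i < d / 2 := di; have {}FM : M - e i < Phi (F i) := FM.
  by move: di FM; move: (e i) => t; lra.
have ba : bnd (fun k => `|a k| : R).
  by exists (`|z| + `|w|) => k; rewrite normr_id /a; case: ifP; rewrite ?lerDl ?lerDr.
have ncst (l : R) : (fun _ : nat => l) @ \oo --> l by exact: cvg_cst.
have limcst (l : R) : limn (fun _ : nat => l) = l.
  exact: (cvg_lim (@norm_hausdorff _ _) (ncst l)).
have /cvg_ex[l al] : cvgn a.
  have aaE : (fun m k => n (a m + a k)) = (fun _ _ => 2 * M).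
    by apply/funext => j; apply/funext => k.
  have aE : (fun k => n (a k)) = (fun=> M) by apply/funext.
  apply: (n_cond ba); rewrite ?aaE ?aE.
  - by split => [_|] /=; [|under eq_fun do rewrite limcst]; exact: cvgP (ncst _).
  - exact: cvgP (ncst _).
  - by rewrite /iterated_lim !limcst.
apply/eqP; rewrite -subr_eq0 -normr_le0; apply/ler_addgt0Pr => d d0; rewrite add0r.
have d20 : 0 < d / 2 by rewrite divr_gt0.
move/cvgrPdist_lt : al => /(_ _ d20)[k _ ak].
have := ak (k.*2) (_ : (k <= k.*2)%N); have := ak (k.*2.+1) (_ : (k <= k.*2.+1)%N).
rewrite /a /= odd_double /= => h1 h2.
rewrite (le_trans (ler_distD l _ _))// [d]splitr lerD//.
  by rewrite distrC ltW// h1// (leq_trans _ (leqnSn _))// -addnn leq_addr.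
by rewrite ltW// h2// -addnn leq_addr.
Qed.

End ConditionAReflexive.

Theorem condition_a_reflexive (R : realType) (V : normedModType R) (n : V -> R) :
  dominated_seminorm n -> (exists2 b : R, 0 < b & forall y, b * `|y| <= n y) ->
  (forall y : V^nat, bnd (fun k => `|y k| : R) -> condition_a n y) ->
  reflexive_space V.
Proof.
move=> ns nlb ncond Phi; have [F FP] := norming_sequence ns Phi.
(* The choice [g = 0] only fixes a reference point: the point found for any other [g] has the same
   [n] and the same values under all [F i]. *)
have [z [_ nz Fz]] := norming_limit ns nlb ncond FP 0.
exists z => g; have [w [-> nw Fw]] := norming_limit ns nlb ncond FP g.
by rewrite (norming_point_unique ns ncond FP nz nw Fz Fw).
Qed.

(** * Transfer of condition (a) to closed subspaces *)

Section Subspace.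
Variables (R : realType) (X : normedModType R).

Lemma bounded_fun_bnd (x : X^nat) : bounded_fun x <-> bnd (fun k => `|x k| : R).
Proof.
split=> [[M [_ /(_ (M + 1))]]|[M xM]].
  rewrite ltrDl => /(_ ltr01) xM.
  by exists (M + 1) => k; rewrite normr_id; exact: xM.
exists M; split; first exact: num_real.
move=> r Mr k _ /=; rewrite -[leLHS]normr_id (le_trans (xM k))//; exact: ltW.
Qed.

Lemma sublmod_cvgn (Y : submodClosed X) (y : (sublmod Y)^nat) :
  closed [set` Y] -> cvgn (fun k => sublmod_val (y k)) -> cvgn y.
Proof.
move=> clY /cvg_ex[z yz].
have zY : z \in Y.
  apply: (closed_cvg _ clY _ _ yz); apply: nearW => k /=; exact: valP (y k).
suff : y k @[k --> \oo] --> (Sublmod zY : sublmod Y) by exact: cvgP.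
by apply/cvgrPdist_lt => e e0; move/cvgrPdist_lt : yz => /(_ e e0).
Qed.

Lemma condition_a_sublmod (N : X -> R) (Y : submodClosed X) : closed [set` Y] ->
  (forall x : X^nat, (forall n, x n \in Y) -> bounded_fun x -> condition_a N x) ->
  forall y : (sublmod Y)^nat, bnd (fun k => `|y k| : R) ->
    condition_a (fun z : sublmod Y => N (sublmod_val z)) y.
Proof.
move=> clY Na y by_ yy_ex y_cvg yy_lim; apply: sublmod_cvgn => //.
apply: Na => // [k|]; first exact: valP (y k).
exact/bounded_fun_bnd.
Qed.

Lemma reflexive_of_condition_a (N : X -> R) (Y : submodClosed X) :
  equivalent_norm N -> closed [set` Y] ->
  (forall x : X^nat, (forall n, x n \in Y) -> bounded_fun x -> condition_a N x) ->
  reflexive_space (sublmod Y).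
Proof.
move=> [ND NZ _ [b [C [b0 _ Nb]]]] clY Na.
apply: (@condition_a_reflexive _ _ (fun z : sublmod Y => N (sublmod_val z))).
- split => [y z|a y|]; [exact: ND|exact: NZ|].
  by exists C => y; have /andP[] := Nb (sublmod_val y).
- by exists b => // y; have /andP[] := Nb (sublmod_val y).
- exact: condition_a_sublmod.
Qed.

End Subspace.

Theorem corollary3p2 (R : realType) (X : completeNormedModType R)
    (sepX : separable_space X) :
  exists2 N : X -> R, equivalent_norm N &
    forall Y : submodClosed X, closed [set` Y] ->
      (reflexive_space (sublmod Y) <->
        (forall x : X^nat, (forall n, x n \in Y) -> bounded_fun x ->
          condition_a N x)) /\
      (reflexive_space (sublmod Y) <->
        (forall x : X^nat, (forall n, x n \in Y) -> bounded_fun x ->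
          condition_a N x /\ condition_b N x)).

Proof.
have [N Neq [Ns [c cd Nsplit]]] := odell_schlumprecht_norm sepX.
have N0 := equivalent_norm_eq0 Neq.
exists N => // Y clY; have aY := reflexive_of_condition_a Neq clY.
have reflexive_a : reflexive_space (sublmod Y) -> forall x : X^nat,
    (forall n, x n \in Y) -> bounded_fun x -> condition_a N x.
  move=> reflY x xY /bounded_fun_bnd bx.
  exact: (reflexive_cvgn Ns N0 cd Nsplit reflY xY bx).
split; split => //.
- move=> reflY x xY bx; split; first exact: reflexive_a.
  move=> wx nx; have /bounded_fun_bnd bx' := bx.
  exact: (reflexive_condition_b cd Nsplit reflY xY bx' wx nx).
- by move=> ab; apply: aY => x xY bx; have [] := ab x xY bx.
Qed.
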